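(* Let $0<\alpha<1$ and let $\{B(t):t\in[0,1]\}$ be a fractional Brownian motion of Hurst index $\alpha$. Then, almost surely, for all $A\subset[0,1]$: (1) if $B|_A$ is $\beta$-Hölder continuous for some $\beta>\alpha$, then $\overline{\dim}_{\mathcal M}A\le1-\alpha$; (2) if $B|_A$ is of bounded variation, then $\overline{\dim}_{\mathcal M}A\le\max\{1-\alpha,\alpha\}$.
   Context: A process $\{B(t):t\ge0\}$ is a fractional Brownian motion of Hurst index $\alpha\in(0,1)$ if $B$ is a Gaussian process with stationary increments, $B(0)=0$, $t^{-\alpha}B(t)$ is standard normal for every $t>0$, and almost surely $t\mapsto B(t)$ is continuous; its covariance is $\mathbb E(B(t)B(s))=\frac12(|t|^{2\alpha}+|s|^{2\alpha}-|t-s|^{2\alpha})$. Here it is restricted to $[0,1]$. Sets $A\subset[0,1]$ are arbitrary non-empty sets. A function $f\colon A\to\mathbb R$ is $\beta$-Hölder continuous if there is $c\in(0,\infty)$ with $|f(x)-f(y)|\le c|x-y|^{\beta}$ for all $x,y\in A$. It is of bounded variation if $\sup\{\sum_{i=1}^{n}|f(x_i)-f(x_{i-1})|: x_0<\dots<x_n,\ x_i\in A,\ n\ge1\}<\infty$. $\overline{\dim}_{\mathcal M}$ is the upper Minkowski (upper box) dimension: for an integer $M\ge2$, $\overline{\dim}_{\mathcal M}A=\limsup_{n\to\infty}\frac{\log N_n(A,M)}{n\log M}$, where $N_n(A,M)$ is the number of intervals $[pM^{-n},(p+1)M^{-n})$, $p\in\{0,\dots,M^n-1\}$, that intersect $A$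 (the value does not depend on $M$). *)

(* Defs.v *)
From mathcomp Require Import all_boot all_order all_algebra.
From mathcomp Require Import all_classical all_reals all_analysis.

Set Implicit Arguments.
Unset Strict Implicit.
Unset Printing Implicit Defensive.

Import Order.TTheory GRing.Theory Num.Theory.
Import numFieldNormedType.Exports.

Local Open Scope classical_set_scope.
Local Open Scope ring_scope.

Definition eq_law d (T : measurableType d) (R : realType)
    (mu nu : set T -> \bar R) : Prop :=
  forall E : set T, measurable E -> mu E = nu E.

(* Point masses count as Gaussian. They are listed separately because
   [normal_prob m 0] is the uniform law on [0, 1], not a point mass. *)
Definition gaussian_law (R : realType)
    (mu : set (measurableTypeR R) -> \bar R) : Prop :=
  exists m : R, eq_law mu (\d_m) \/
                exists2 s : R, 0 < s & eq_law mu (normal_prob m s).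

Section processes.
Context d (T : measurableType d) (R : realType) (P : probability T R).
Implicit Types (I : set R) (B : R -> {RV P >-> R}).

(* In this section a process has time set [I]; the random variables [B t] with
   [t] outside [I] are never constrained. *)

Definition gaussian_process I B : Prop :=
  forall (n : nat) (t c : 'I_n -> R), (forall i, I (t i)) ->
    gaussian_law (pushforward P (fun w => \sum_(i < n) c i * B (t i) w)).

(* (B (t + h) - B h)_t and (B t - B 0)_t have the same finite-dimensional
   distributions, for the times at which both are defined. *)
Definition stationary_increments I B : Prop :=
  forall (n : nat) (t : 'I_n -> R) (h : R),
    I 0 -> I h -> (forall i, I (t i)) -> (forall i, I (t i + h)) ->
    eq_law
      (pushforward P (fun w => [tuple B (t i + h) w - B h w | i < n]))
      (pushforward P (fun w => [tuple B (t i) w - B 0 w | i < n])).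

Record fractional_brownian_motion I (alpha : R) B : Prop := {
  fbm_gaussian : gaussian_process I B;
  fbm_stationary : stationary_increments I B;
  fbm0 : I 0 -> {ae P, forall w, B 0 w = 0};
  fbm_normal : forall t, I t -> 0 < t ->
    eq_law (pushforward P (fun w => t `^ (- alpha) * B t w)) (normal_prob 0 1);
  fbm_continuous : {ae P, forall w, {within I, continuous (fun t => B t w)}}
}.

Lemma fractional_brownian_motionS I J alpha B : J `<=` I ->
  fractional_brownian_motion I alpha B -> fractional_brownian_motion J alpha B.
Proof.
move=> JI [G S Z N C]; split.
- by move=> n t c Jt; apply: G => i; exact: JI.
- move=> n t h J0 Jh Jt Jth.
  by apply: S => [||i|i]; exact: JI.
- by move=> /JI; exact: Z.
- by move=> t /JI; exact: N.
- by apply: filterS C => w; exact: continuous_subspaceW.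
Qed.

End processes.

Section functions.
Context (R : realType).
Implicit Types (A : set R) (f : R -> R).

Definition holder_on A (beta : R) f : Prop :=
  exists2 c : R, 0 < c &
    forall x y, A x -> A y -> `|f x - f y| <= c * `|x - y| `^ beta.

(* Only the values [x 0, ..., x n] of the sequence [x] are used. *)
Definition variations_on A f : set R :=
  [set v | exists (n : nat) (x : nat -> R),
    [/\ (1 <= n)%N,
        forall i, (i <= n)%N -> A (x i),
        forall i, (i < n)%N -> x i < x i.+1 &
        v = \sum_(1 <= i < n.+1) `|f (x i) - f (x i.-1)| ] ].

Definition bounded_variation_on A f : Prop := has_ubound (variations_on A f).

Definition box_count A (M n : nat) : nat :=
  #|[pred p : 'I_(M ^ n) |
      `[< A `&` `[p%:R / M%:R ^+ n, p.+1%:R / M%:R ^+ n[ !=set0 >] ]|.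

(* For nonempty A included in [0, 1] the box count vanishes only if A = {1};
   the convention ln 0 = 0 then gives dimension 0. *)
Definition upper_minkowski_dim (M : nat) A : \bar R :=
  limn_esup (fun n => (ln (box_count A M n)%:R / (n%:R * ln M%:R))%:E).

End functions.

(* Main.v *)
From HB Require Import structures.
Require Import Defs.
From mathcomp Require Import all_boot all_order all_algebra.
From mathcomp Require Import all_classical all_reals all_analysis.
From mathcomp Require Import measurable_realfun ring lra zify.

Set Implicit Arguments.
Unset Strict Implicit.
Unset Printing Implicit Defensive.

Import Order.TTheory GRing.Theory Num.Theory.
Import numFieldNormedType.Exports.

Local Open Scope classical_set_scope.
Local Open Scope ring_scope.

(** Cut [0, 1] into the cells of level n, of length M^-n, and call a cell hit
    when it meets A.  Both dimension bounds rest on one almost sure fact: inside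
    a block (a cell of level n - l) along which B restricted to A oscillates by
    O(M^-(n alpha)), at most C M^(2 n delta + l (1 - alpha)) cells of level n are
    hit, simultaneously for all sets A, levels and blocks.

    This holds because B cannot come back too often.  Fractional Brownian motion
    is locally nondeterministic ([local_nondeterminism]): the variance of a
    combination of consecutive increments dominates a constant multiple of the
    sum of the separate variances.  The mean square of such a combination is
    determined by the variogram |t - u|^(2 alpha), which is also, up to a
    constant, that of the translates of the one-sided kernel x_+^(alpha - 1/2) in L^2
    ([ma_kernel_isometry]); on the side of the kernels, the lower bound is
    visible on the interval where only the last kernel is alive.  A dominated
    characteristic function gives a small-ball estimate
    ([gaussian_small_ball]): exp(-x^2/2) is the expectation of
    cos(x Z) for a standard normal Z, so that Fubini's theorem removes the
    Gaussian weights one variable at a time.  Hence, for t_0 < ... < t_Q, the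
    expectation of the product of the exp(-((B(t_(i+1)) - B(t_i)) / e)^2 / 2) is
    at most a constant times the product of the e / (t_(i+1) - t_i)^alpha
    ([increments_small_ball]).

    Summing these products over increasing chains of Q grid points starting at i
    and confined to a window of M^l cells gives a chain weight.  Its expectation
    is at most of the order of the Q-th power of M^(n delta) M^(l (1 - alpha))
    ([expected_chain_weight_le], [sum_powRN_le]), whereas s further grid points
    of the window at which B is within O(e) of its value at i, and of each other,
    with e = M^-(n (alpha - delta)), force it to be at least a constant times
    the binomial of s and Q ([chain_weight_ge]).  As Q is fixed but as large as desired, a
    first moment bound, summed over all starting points and all scales
    ([ae_bounded_of_geometric]), costs only M^(n delta) ([ae_chain_weights]).
    The increments over cells are controlled in the same way, and chaining
    together with continuity shows that B oscillates by O(M^-(n (alpha - delta)))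
    in every cell of level n ([cell_oscillation]), so that a hit cell may be
    replaced by its left end point.

    The rest is deterministic.  A block is bad when B restricted to A oscillates
    there by more than a constant times M^-(n alpha).  For l close to n / K with
    K large, a beta-Hoelder restriction with beta > alpha has no bad block
    ([holder_no_bad_cell]), and a restriction of bounded variation has at most
    O(M^(n alpha)) of them ([bounded_variation_bad_cells]).  Counting hit cells
    block by block,
      N_n <= C M^(2 n delta + l (1 - alpha)) N_(n-l) + #bad M^l,
    and this recursion yields the exponents 1 - alpha and max(1 - alpha, alpha)
    ([growth_recursion], [box_count_growth]). *)

(** * Integration against normal laws *)

Section affine.
Context (R : realType).
Local Notation mu := (@lebesgue_measure R).

Let affine (a b : R) (x : measurableTypeR R) : measurableTypeR R := a * x + b.

Let measurable_affine (a b : R) : measurable_fun setT (affine a b).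
Proof. by apply: measurable_funD => //; exact: measurable_funM. Qed.

Let pushforward_affine (a b : R) : {measure set (measurableTypeR R) -> \bar R}.
Proof. by refine (pushforward mu (affine a b)); exact: measurable_affine. Defined.

Let lebesgue_measure_affine (a b : R) (a0 : 0 < a) (A : set R) : measurable A ->
  mu A = mscale (NngNum (ltW a0)) (pushforward_affine a b) A.
Proof.
apply: lebesgue_measure_unique => // _ [[u v]] _ <-.
change (mu `]u, v] = (a%:E * mu (affine a b @^-1` `]u, v]%classic))%E).
have -> : affine a b @^-1` `]u, v]%classic = [set` `](u - b) / a, (v - b) / a]%R].
  apply/seteqP; split => x /=; rewrite /affine/= !in_itv/= ltr_pdivrMr//;
  by rewrite ler_pdivlMr// ltrBlDr lerBrDr mulrC.
rewrite !lebesgue_measure_itv/= !lte_fin ltr_pM2r ?invr_gt0// ltrD2r.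
case: ifP => _; last by rewrite mule0.
by rewrite -EFinM; congr EFin; field; rewrite gt_eqF.
Qed.

Lemma ge0_integral_affine (a b : R) (g : R -> \bar R) : 0 < a ->
  measurable_fun setT g -> (forall x, 0 <= g x)%E ->
  (\int[mu]_x g x = a%:E * \int[mu]_x g (a * x + b)%R)%E.
Proof.
move=> a0 mg g0.
transitivity (\int[mscale (NngNum (ltW a0)) (pushforward_affine a b)]_x g x)%E.
  by apply: eq_measure_integral => A mA _; exact: lebesgue_measure_affine.
rewrite ge0_integral_mscale//; congr (_ * _)%E.
by rewrite ge0_integral_pushforward ?preimage_setT//; exact: measurable_affine.
Qed.

End affine.

Section normal.
Context (R : realType).
Local Notation mu := (@lebesgue_measure R).

(** Change of variables holds for the Radon-Nikodym derivative of [normal_prob],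
    which agrees almost everywhere with [normal_pdf] because both have the same
    integral on every measurable set. *)
Lemma ge0_integral_normal_prob (m s : R) (f : R -> \bar R) :
  measurable_fun setT f -> (forall x, 0 <= f x)%E ->
  (\int[normal_prob m s]_x f x = \int[mu]_x (f x * (normal_pdf m s x)%:E))%E.
Proof.
move=> mf f0.
have dom := normal_prob_dominates m s.
rewrite -(Radon_Nikodym_SigmaFinite.change_of_variables dom f0 measurableT mf).
have ifn := Radon_Nikodym_SigmaFinite.f_integrable dom.
have mn : measurable_fun [set: R] (fun x => (normal_pdf m s x)%:E).
  by apply/measurable_EFinP; exact: measurable_normal_pdf.
apply: ge0_ae_eq_integral => //.
- by apply: emeasurable_funM => //; exact: measurable_int ifn.
- by apply: emeasurable_funM.
- by move=> x _; apply: mule_ge0 => //; exact: Radon_Nikodym_SigmaFinite.f_ge0.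
- by move=> x _; apply: mule_ge0 => //; rewrite lee_fin normal_pdf_ge0.
- apply: ae_eqe_mul2l; apply: integral_ae_eq => // E _ mE.
  by rewrite -Radon_Nikodym_SigmaFinite.f_integral.
Qed.

Lemma integral_normal_prob (m s : R) (f : R -> R) : measurable_fun setT f ->
  (\int[normal_prob m s]_x (f x)%:E = \int[mu]_x (f x * normal_pdf m s x)%:E)%E.
Proof.
move=> mf; have mf' : measurable_fun setT (EFin \o f) by exact/measurable_EFinP.
rewrite [LHS]integralE [RHS]integralE.
rewrite !ge0_integral_normal_prob//; last 2 first.
- exact: measurable_funeneg.
- exact: measurable_funepos.
have p0 x : (0 <= (normal_pdf m s x)%:E)%E by rewrite lee_fin normal_pdf_ge0.
congr (_ - _)%E; apply: eq_integral => x _.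
  by rewrite !funeposE /= maxe_pMl// mul0e.
by rewrite !funenegE /= maxe_pMl// mul0e -EFinM mulNr.
Qed.

Lemma normal_pdf_standard (m s z : R) : 0 < s ->
  s * normal_pdf m s (s * z + m) = normal_pdf 0 1 z.
Proof.
move=> s0; rewrite !normal_pdfE ?gt_eqF//= /normal_peak /normal_fun.
rewrite addrK subr0 mulrA; congr (_ * expR _).
  rewrite expr1n mul1r -mulrnAr sqrtrM ?sqr_ge0// sqrtr_sqr gtr0_norm// invfM.
  by rewrite mulrA divff ?gt_eqF// mul1r.
by field; rewrite gt_eqF.
Qed.

Lemma ge0_integral_normal_standard (m s : R) (f : R -> \bar R) : 0 < s ->
  measurable_fun setT f -> (forall x, 0 <= f x)%E ->
  (\int[normal_prob m s]_x f x = \int[normal_prob 0 1]_z f (s * z + m)%R)%E.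
Proof.
move=> s0 mf f0.
have mn m' s' : measurable_fun [set: R] (fun x => (normal_pdf m' s' x)%:E).
  by apply/measurable_EFinP; exact: measurable_normal_pdf.
have n0 m' s' x : (0 <= (normal_pdf m' s' x)%:E)%E by rewrite lee_fin normal_pdf_ge0.
have mfa : measurable_fun [set: R] (fun z => f (s * z + m)%R).
  by apply: (measurableT_comp mf); apply: measurable_funD => //; exact: measurable_funM.
rewrite (ge0_integral_normal_prob m s mf f0).
rewrite (ge0_integral_normal_prob 0 1 mfa (fun z => f0 _)).
rewrite (ge0_integral_affine m s0); last 2 first.
- exact: emeasurable_funM.
- by move=> x; apply: mule_ge0.
rewrite -ge0_integralZl_EFin ?ltW//; last 2 first.
- by move=> x _; apply: mule_ge0.
- apply: (measurableT_comp (emeasurable_funM mf (mn m s))) => //.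
  by apply: measurable_funD => //; exact: measurable_funM.
apply: eq_integral => z _.
by rewrite -(normal_pdf_standard m z s0) EFinM muleCA.
Qed.

Local Notation phi := (normal_pdf (0 : R) 1).

(** The ratio of two centred normal densities is the exponential of a quadratic.
    It turns a Gaussian weight under a standard normal law into a total mass: with
    s < 1 this integrates exp(-(b z)^2/2), and with s = sqrt 2 it integrates the
    growing weight exp(z^2/4). *)
Lemma normal_pdf_widen (s x : R) : 0 < s ->
  expR (x ^+ 2 / 2 - x ^+ 2 / (2 * s ^+ 2)) * phi x = s * normal_pdf 0 s x.
Proof.
move=> s0; rewrite !normal_pdfE ?gt_eqF//= /normal_peak /normal_fun subr0.
rewrite expr1n mul1r -[(s ^+ 2 * pi *+ 2)]mulrnAr sqrtrM ?sqr_ge0// sqrtr_sqr.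
rewrite gtr0_norm// mulrCA -expRD !mulrA.
have -> q : s / (s * q) = q^-1 by rewrite invfM mulrA divff ?gt_eqF// mul1r.
by congr (_ * expR _); field; rewrite gt_eqF.
Qed.

Lemma gauss_weight (s : R) : 0 < s ->
  (\int[normal_prob 0 1]_x (expR (x ^+ 2 / 2 - x ^+ 2 / (2 * s ^+ 2)))%:E = s%:E)%E.
Proof.
move=> s0; rewrite ge0_integral_normal_prob//; last first.
  apply/measurable_EFinP/measurableT_comp => //; apply: measurable_funB;
  by apply: measurable_funM => //; exact: measurable_funX.
transitivity (\int[mu]_x (s%:E * (normal_pdf 0 s x)%:E))%E.
  by apply: eq_integral => x _; rewrite -EFinM normal_pdf_widen.
rewrite integralZl//; first by rewrite integral_normal_pdf mule1.
exact: integrable_normal_pdf.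
Qed.

(** The bound 1 + x^2 <= 4 exp(x^2/4) compares [f * phi] with a multiple of the
    density of variance 2. *)
Lemma integrable_quadratic_growth (f : R -> R) (C : R) : measurable_fun setT f ->
  (forall x, `|f x| <= C * (1 + x ^+ 2)) ->
  mu.-integrable setT (fun x => (f x * phi x)%:E).
Proof.
move=> mf fC.
have C0 : 0 <= C.
  by have := le_trans (normr_ge0 _) (fC 0); rewrite expr0n addr0 mulr1.
apply: (@le_integrable _ (measurableTypeR R) R mu setT measurableT _
  (fun x => (4 * C * Num.sqrt 2 * normal_pdf 0 (Num.sqrt 2) x)%:E)).
- by apply/measurable_EFinP; apply: measurable_funM => //; exact: measurable_normal_pdf.
- move=> x _; rewrite lee_fin normrM [`|phi x|]ger0_norm ?normal_pdf_ge0//.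
  rewrite [leRHS]ger0_norm; last first.
    by rewrite mulr_ge0 ?normal_pdf_ge0// !mulr_ge0.
  rewrite -[leRHS]mulrA -normal_pdf_widen ?sqrtr_gt0// sqr_sqrtr// mulrA.
  rewrite ler_wpM2r ?normal_pdf_ge0//; apply: (le_trans (fC x)).
  rewrite [4 * C]mulrC -mulrA ler_wpM2l//.
  have := expR_ge1Dx (x ^+ 2 / 2 - x ^+ 2 / (2 * 2)).
  by have := sqr_ge0 x; lra.
- under eq_fun do rewrite EFinM.
  by apply: integrableZl => //; exact: integrable_normal_pdf.
Qed.

(** The integral over [-n, n] is F(n) - F(-n), which is O(1/n); the integral over
    the line is its limit by dominated convergence.  This is the form in which
    integration by parts against the normal density is used. *)
Lemma integral_derivative_eq0 (F f : R -> R) (C : R) :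
  (forall x, is_derive x (1 : R) F (f x)) -> continuous f ->
  mu.-integrable setT (EFin \o f) ->
  (forall x, `|F x| * `|x| <= C) ->
  (\int[mu]_x (f x)%:E = 0)%E.
Proof.
move=> dF cf intf FC.
have mf : measurable_fun setT f by apply/measurable_EFinP; exact: (measurable_int mu intf).
pose J n := [set` `[- n.+1%:R, n.+1%:R : R]%R].
pose f_ (n : nat) (x : R) := (\1_(J n) x * f x)%:E.
have mf_ n : measurable_fun [set: measurableTypeR R] (f_ n).
  apply/measurable_EFinP; apply: measurable_funM; last exact: mf.
  by apply: measurable_indic; exact: measurable_itv.
have f_f x : f_ n x @[n --> \oo] --> (f x)%:E.
  apply: cvg_near_cst; near=> n.
  rewrite /f_ indicE mem_set ?mul1r// /J /= in_itv/= -ler_norml.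
  near: n; exists (Num.truncn `|x|) => // n /= xn.
  by rewrite (le_trans (ltW (truncnS_gt _)))// ler_nat ltnS.
have f_le x n : (`|f_ n x| <= `|(f x)%:E|)%E.
  rewrite /f_ lee_fin normrM ler_piMl// indicE.
  by case: (_ \in _); rewrite ?normr1 ?normr0.
have [_ _ cvgf] := @dominated_convergence _ (measurableTypeR R) R mu setT measurableT
  f_ (EFin \o f) (fun x => `|(f x)%:E|%E) mf_ (measurable_int mu intf)
  (aeW mu (fun x _ => f_f x)) (integrable_abse intf) (aeW mu (fun x n _ => f_le x n)).
have If_ n : (\int[mu]_x f_ n x = (F n.+1%:R - F (- n.+1%:R))%:E)%E.
  rewrite EFinB -(@continuous_FTC2 R f F).
  - rewrite [RHS]integral_mkcond; apply: eq_integral => x _.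
    rewrite /f_ patchE indicE; case: ifPn => _; by rewrite ?mul1r ?mul0r.
  - by rewrite -subr_gt0 opprK -natrD ltr0n.
  - exact: continuous_subspaceT.
  - have cF : continuous F.
      by move=> x; apply/differentiable_continuous/derivable1_diffP; have := dF x => -[].
    split; first by move=> x _; have := dF x => -[].
    + exact/cvg_at_right_filter/cF.
    + exact/cvg_at_left_filter/cF.
  - by move=> x _; rewrite derive1E; have := dF x => dFx; rewrite derive_val.
have F_le x y : `|x| = y -> 0 < y -> `|F x| <= C / y.
  by move=> <- x0; rewrite ler_pdivlMr.
have cvg0 : (\int[mu]_x f_ n x)%E @[n --> \oo] --> 0%E.
  rewrite (eq_cvg _ _ If_); apply: cvg_EFin; first exact: nearW.
  apply/norm_cvg0P.
  apply: (@squeeze_cvgr _ _ _ _ (cst 0) (fun n => 2 * C * n.+1%:R^-1)).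
  - apply: nearW => n; rewrite normr_ge0/=.
    rewrite (le_trans (ler_normB _ _))// -mulrA mulr_natl mulr2n.
    by apply: lerD; apply: F_le; rewrite ?normrN ?ger0_norm ?ltr0n.
  - exact: cvg_cst.
  - rewrite -[X in _ --> X](mulr0 (2 * C)); apply: cvgM; first exact: cvg_cst.
    exact: cvg_harmonic.
exact: (cvg_unique _ cvgf cvg0).
Unshelve. all: end_near. Qed.

End normal.

(** * The Fourier transform of the standard normal density *)

Section charfun.
Context (R : realType).
Local Notation mu := (@lebesgue_measure R).
Local Notation phi := (normal_pdf (0 : R) 1).

Lemma standard_normal_pdfE (x : R) : phi x = normal_peak 1 * expR (- (x ^+ 2 / 2)).
Proof.
by rewrite normal_pdfE ?oner_eq0//= /normal_fun subr0 expr1n mulNr.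
Qed.

Lemma is_derive_standard_normal_pdf (x : R) : is_derive x 1 phi (- (x * phi x)).
Proof.
rewrite (_ : phi = fun x => normal_peak 1 * expR (- (x ^+ 2 / 2))); last first.
  by apply/funext => y; rewrite standard_normal_pdfE.
apply: is_derive_eq; rewrite /GRing.scale/= !mulr0 add0r !mulr1. by field.
Qed.

Lemma standard_normal_pdf_decay (x : R) : phi x * (1 + x ^+ 2) <= 2 * normal_peak 1.
Proof.
rewrite standard_normal_pdfE -mulrA [leRHS]mulrC ler_wpM2l ?normal_peak_ge0//.
rewrite expRN mulrC ler_pdivrMr ?expR_gt0//.
have := expR_ge1Dx (x ^+ 2 / 2); have := sqr_ge0 x; lra.
Qed.

Lemma is_derive_cos_affine (y u x : R) :
  is_derive u (1 : R) (fun u => cos (y + u * x)) (- (x * sin (y + u * x))).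
Proof.
have : is_derive u (1 : R) (fun u => y + u * x) x.
  by apply: is_derive_eq; rewrite /GRing.scale/=; ring.
move=> d; have := @is_derive1_comp R cos _ _ _ _ (is_derive_cos _) d.
by rewrite mulNr mulrC.
Qed.

Lemma is_derive_sin_affine (y u x : R) :
  is_derive x (1 : R) (fun x => sin (y + u * x)) (u * cos (y + u * x)).
Proof.
have : is_derive x (1 : R) (fun x => y + u * x) u.
  by apply: is_derive_eq; rewrite /GRing.scale/=; ring.
move=> d; have := @is_derive1_comp R sin _ _ _ _ (is_derive_sin _) d.
by rewrite mulrC.
Qed.

Lemma norm_le_1Dsqr (x : R) : `|x| <= 1 + x ^+ 2.
Proof.
have := sqr_ge0 (`|x| - 1); have := normr_ge0 x.
by rewrite -[x ^+ 2]real_normK ?num_real//; nra.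
Qed.

Lemma standard_normal_mean : (\int[mu]_x (x * phi x)%:E = 0)%E.
Proof.
have d x : is_derive x (1 : R) (- phi) (x * phi x).
  have dp := is_derive_standard_normal_pdf x.
  by apply: is_derive_eq; rewrite opprK.
apply: (integral_derivative_eq0 (C := 2 * normal_peak 1) d).
- move=> x; apply: cvgM; first exact: cvg_id.
  by apply: continuous_normal_pdf; rewrite oner_eq0.
- apply: (integrable_quadratic_growth (f := id) (C := 1)); first exact: measurable_id.
  by move=> x; rewrite mul1r norm_le_1Dsqr.
- move=> x; rewrite normrN ger0_norm ?normal_pdf_ge0//.
  apply: le_trans (standard_normal_pdf_decay x).
  by rewrite ler_wpM2l ?normal_pdf_ge0// norm_le_1Dsqr.
Qed.

Lemma standard_normal_variance : (\int[mu]_x (x ^+ 2 * phi x)%:E = 1)%E.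
Proof.
have d x : is_derive x (1 : R) (fun x => x * phi x) (phi x - x ^+ 2 * phi x).
  have dp := is_derive_standard_normal_pdf x.
  by apply: is_derive_eq; rewrite /GRing.scale/=; ring.
have cphi : continuous phi by apply: continuous_normal_pdf; rewrite oner_eq0.
have i2 : mu.-integrable setT (fun x => (x ^+ 2 * phi x)%:E).
  apply: (integrable_quadratic_growth (f := fun x => x ^+ 2) (C := 1)).
    exact: measurable_funX.
  by move=> x; rewrite mul1r ger0_norm ?sqr_ge0// lerDr.
have := integrable_normal_pdf (0 : R) 1 => i0.
have h : (\int[mu]_x (phi x - x ^+ 2 * phi x)%:E = 0)%E; last first.
  have fI := integrable_fin_num measurableT i2.
  move: h; rewrite integralB_EFin// integral_normal_pdf -(fineK fI) -EFinB => -[] /eqP.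
  by rewrite subr_eq0 => /eqP <-.
apply: (integral_derivative_eq0 (C := 2 * normal_peak 1) d).
- move=> x; apply: cvgB; first exact: cphi.
  by apply: cvgM; [exact: exprn_continuous|exact: cphi].
- rewrite /comp; under eq_fun do rewrite EFinB.
  exact: integrableB.
- move=> x; rewrite normrM [`|phi x|]ger0_norm ?normal_pdf_ge0//.
  apply: le_trans (standard_normal_pdf_decay x).
  rewrite mulrAC -normrM -expr2 mulrC ler_wpM2l ?normal_pdf_ge0//.
  by rewrite ger0_norm ?sqr_ge0// lerDr.
Qed.

(** As a function of u the integral G satisfies G'(u) = - u G(u): differentiate
    under the integral sign, then integrate by parts with phi' = - x phi.  Hence
    G(u) exp(u^2/2) is constant.  The phase y makes the formula applicable to one
    term of a sum at a time. *)
Lemma integral_cos_affine (y u : R) :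
  (\int[mu]_x (cos (y + u * x) * phi x) = cos y * expR (- (u ^+ 2 / 2)))%R.
Proof.
have cphi : continuous phi by apply: continuous_normal_pdf; rewrite oner_eq0.
have caff v : continuous (fun x : R => y + v * x).
  by move=> x; apply: cvgD; [exact: cvg_cst|apply: cvgM; [exact: cvg_cst|exact: cvg_id]].
have ccos v : continuous (fun x : R => cos (y + v * x)).
  by move=> x; apply: continuous_comp; [exact: caff|exact: continuous_cos].
have csin v : continuous (fun x : R => sin (y + v * x)).
  by move=> x; apply: continuous_comp; [exact: caff|exact: continuous_sin].
have mcos v : measurable_fun setT (fun x : R => cos (y + v * x)).
  exact: continuous_measurable_fun.
have msin v : measurable_fun setT (fun x : R => sin (y + v * x)).
  exact: continuous_measurable_fun.
have icos v : mu.-integrable setT (EFin \o (fun x => cos (y + v * x) * phi x)).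
  apply: (integrable_quadratic_growth (C := 1)); first exact: mcos.
  by move=> x; rewrite mul1r (@le_trans _ _ 1) ?cos_max// lerDl sqr_ge0 //.
have ixsin v : mu.-integrable setT (EFin \o (fun x => x * sin (y + v * x) * phi x)).
  apply: (integrable_quadratic_growth (C := 1)); first exact: measurable_funM.
  by move=> x; rewrite mul1r (le_trans _ (norm_le_1Dsqr x))// normrM ler_piMr// sin_max.
pose G v := \int[mu]_x (cos (y + v * x) * phi x).
(* integration by parts: (sin (y + v x) phi)' integrates to 0 *)
have ibp : forall v, (\int[mu]_x (x * sin (y + v * x) * phi x))%R = v * G v.
  move=> v.
  have d x : is_derive x (1 : R) (fun x => sin (y + v * x) * phi x)
      (v * (cos (y + v * x) * phi x) - x * sin (y + v * x) * phi x).
    have dp := is_derive_standard_normal_pdf x; have ds := is_derive_sin_affine y v x.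
    by apply: is_derive_eq; rewrite /GRing.scale/=; ring.
  have ivcos : mu.-integrable setT (EFin \o (fun x => v * (cos (y + v * x) * phi x))).
    rewrite /comp; under eq_fun do rewrite EFinM.
    by apply: integrableZl => //; exact: icos.
  have : (\int[mu]_x (v * (cos (y + v * x) * phi x) - x * sin (y + v * x) * phi x))%R = 0.
    rewrite /Rintegral (integral_derivative_eq0 (C := 2 * normal_peak 1) d)//.
    - move=> x; apply: cvgB; apply: cvgM; try exact: cphi; first exact: cvg_cst.
      + apply: cvgM; last exact: cphi.
        exact: ccos.
      + by apply: cvgM; [exact: cvg_id|exact: csin].
    - rewrite /comp; under eq_fun do rewrite EFinB.
      by apply: integrableB => //; exact: ixsin.
    - move=> x; rewrite normrM mulrAC mulrC [`|phi x|]ger0_norm ?normal_pdf_ge0//.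
      apply: le_trans (standard_normal_pdf_decay x).
      rewrite ler_wpM2l ?normal_pdf_ge0// (le_trans _ (norm_le_1Dsqr x))//.
      by rewrite ler_piMl// sin_max.
  rewrite RintegralB//.
  by rewrite RintegralZl// => /eqP; rewrite subr_eq0 => /eqP <-.
have dG : forall v, is_derive v (1 : R) G (- (v * G v)).
  move=> v.
  have v1 : `](v : R) - 1, v + 1[%classic v by rewrite /= in_itv/= gtrBl ltr01 ltrDl ltr01.
  have dcos u' x : is_derive u' (1 : R) (fun u => cos (y + u * x) * phi x)
      (- (x * sin (y + u' * x) * phi x)).
    have dc := is_derive_cos_affine y u' x.
    by apply: is_derive_eq; rewrite /GRing.scale/=; ring.
  have p1 u' x : partial1of2 (fun u x => cos (y + u * x) * phi x) u' x =
      - (x * sin (y + u' * x) * phi x).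
    by rewrite partial1of2E; have := dcos u' x => dcx; rewrite derive_val.
  have dd (u' x : R) : derivable (fun u : R => cos (y + u * x) * phi x) u' 1.
    by have := dcos u' x => -[].
  pose g x := (1 + x ^+ 2) * phi x.
  have g0 x : 0 <= g x by rewrite mulr_ge0 ?normal_pdf_ge0// addr_ge0// sqr_ge0.
  have ig : mu.-integrable setT (EFin \o g).
    apply: (integrable_quadratic_growth (C := 1)).
      by apply: measurable_funD => //; exact: measurable_funX.
    by move=> x; rewrite mul1r ger0_norm// addr_ge0// sqr_ge0.
  have gub u' x : `|partial1of2 (fun u x => cos (y + u * x) * phi x) u' x| <= g x.
    rewrite p1 normrN normrM [`|phi x|]ger0_norm ?normal_pdf_ge0//.
    rewrite ler_wpM2r ?normal_pdf_ge0// (le_trans _ (norm_le_1Dsqr x))//.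
    by rewrite normrM ler_piMr// sin_max.
  apply: DeriveDef.
    exact: (derivable_under_integral measurableT v1 (fun u' _ => icos u')
      (fun u' x _ _ => dd u' x) g0 ig (fun u' x _ _ => gub u' x)).
  rewrite -derive1E (differentiation_under_integral measurableT v1 (fun u' _ => icos u')
      (fun u' x _ _ => dd u' x) g0 ig (fun u' x _ _ => gub u' x)).
  rewrite -ibp.
  transitivity (\int[mu]_x (-1 * (x * sin (y + v * x) * phi x)))%R.
    by apply: eq_Rintegral => x _; rewrite p1 mulN1r.
  by rewrite RintegralZl ?mulN1r//; exact: ixsin.
(* integrating factor of G' = - v G *)
have dH v : is_derive v (1 : R) (fun v => G v * expR (v ^+ 2 / 2)) 0.
  have := dG v => dGv.
  by apply: is_derive_eq; rewrite /GRing.scale/=; field.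
have := is_derive_0_is_cst u 0 dH.
rewrite expr0n mul0r expR0 mulr1 => GE.
rewrite -/(G u) expRN -[LHS](mulfK (lt0r_neq0 (expR_gt0 (u ^+ 2 / 2)))) GE.
congr (_ / _); rewrite /G.
transitivity (\int[mu]_x (cos y * phi x))%R.
  by apply: eq_Rintegral => x _; rewrite mul0r addr0.
rewrite RintegralZl//; last exact: integrable_normal_pdf.
by rewrite /Rintegral integral_normal_pdf/= mulr1.
Qed.

End charfun.

(** * Small-ball estimates from characteristic functions *)

Section fourier.
Context (R : realType).
Local Notation N := (normal_prob (0 : R) 1).

Lemma measurable_cos : measurable_fun [set: R] (@cos R).
Proof. by apply: continuous_measurable_fun => x; exact: continuous_cos. Qed.

Lemma measurable_gauss_weight (b : R) :
  measurable_fun [set: R] (fun z => expR (- ((b * z) ^+ 2 / 2))).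
Proof.
apply: measurableT_comp => //; apply: measurableT_comp => //.
by apply: measurable_funM => //; apply: measurable_funX; exact: measurable_funM.
Qed.

Lemma integral_normal_cos (y x : R) :
  (\int[N]_z (cos (y + x * z))%:E = (cos y * expR (- (x ^+ 2 / 2)))%:E)%E.
Proof.
have mf : measurable_fun [set: R] (fun z => cos (y + x * z)).
  apply: (measurableT_comp measurable_cos).
  by apply: measurable_funD => //; exact: measurable_funM.
rewrite integral_normal_prob// -integral_cos_affine /Rintegral fineK//.
apply: (integrable_fin_num measurableT).
apply: (integrable_quadratic_growth (C := 1)) => // z.
by rewrite mul1r (@le_trans _ _ 1) ?cos_max// lerDl sqr_ge0.
Qed.

Lemma normal_gauss_weight_le (b : R) : 0 < b ->
  (\int[N]_z (expR (- ((b * z) ^+ 2 / 2)))%:E <= (b^-1)%:E)%E.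
Proof.
move=> b0; pose s := (Num.sqrt (1 + b ^+ 2))^-1.
have b2 : 0 < 1 + b ^+ 2 by rewrite addr_gt0// exprn_gt0.
have s0 : 0 < s by rewrite invr_gt0 sqrtr_gt0.
have s2 : s ^+ 2 = (1 + b ^+ 2)^-1 by rewrite exprVn sqr_sqrtr// ltW.
have -> : (\int[N]_z (expR (- ((b * z) ^+ 2 / 2)))%:E = s%:E)%E.
  rewrite -(gauss_weight s0); apply: eq_integral => z _; congr (expR _)%:E.
  by rewrite s2; field; rewrite gt_eqF.
rewrite lee_fin lef_pV2 ?posrE ?sqrtr_gt0//.
by rewrite -[leLHS]gtr0_norm// -sqrtr_sqr ler_wsqrtr// lerDr.
Qed.

Context d (T : measurableType d) (P : probability T R).

(** Since exp(-X^2/2) cos(Y) is the expectation of cos(Y + X Z) over an independent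
    standard normal Z, Fubini's theorem trades the Gaussian weight for a free real
    parameter z inside the cosine.  The assumed Gaussian decay in z is then
    integrated against the law of Z, which costs a factor 1/b. *)
Lemma gaussian_weight_step (X Y G : T -> R) (K b : R) :
  measurable_fun setT X -> measurable_fun setT Y -> measurable_fun setT G ->
  (forall w, 0 <= G w <= 1) -> 0 < b ->
  (forall z, `|\int[P]_w (cos (Y w + X w * z) * G w)| <= K * expR (- ((b * z) ^+ 2 / 2)))%R ->
  (`|\int[P]_w (cos (Y w) * (expR (- (X w ^+ 2 / 2)) * G w))| <= K / b)%R.
Proof.
move=> mX mY mG G01 b0 hz.
have K0 : 0 <= K.
  by have := le_trans (normr_ge0 _) (hz 0); rewrite pmulr_lge0// expR_gt0.
pose h (u : T * measurableTypeR R) : R := cos (Y u.1 + X u.1 * u.2) * G u.1.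
have mh : measurable_fun setT h.
  apply: measurable_funM.
    apply: (measurableT_comp measurable_cos); apply: measurable_funD.
      exact: measurableT_comp.
    by apply: measurable_funM => //; exact: measurableT_comp.
  exact: measurableT_comp.
have h1 u : `|h u| <= 1.
  have /andP[g0 g1] := G01 u.1.
  by rewrite normrM mulr_ile1// ?cos_max// ger0_norm.
have ih : (P \x N)%E.-integrable setT (EFin \o h).
  apply: measurable_bounded_integrable => //.
    have PN1 : (P \x N)%E setT = 1%E by exact: probability_setT.
    by apply: (le_lt_trans (y := 1%E)); [rewrite -PN1|exact: ltry].
  by exists 1; split => // M M1 u _; apply: le_trans (h1 u) (ltW M1).
have := Fubini ih.
have -> : (\int[P]_w \int[N]_z (EFin \o h) (w, z) =
   \int[P]_w (cos (Y w) * (expR (- (X w ^+ 2 / 2)) * G w))%:E)%E.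
  apply: eq_integral => w _.
  rewrite /h/=; under eq_integral do rewrite mulrC EFinM.
  have mc : measurable_fun [set: measurableTypeR R] (fun z => cos (Y w + X w * z)).
    apply: (measurableT_comp measurable_cos).
    by apply: measurable_funD => //; exact: measurable_funM.
  rewrite integralZl//.
    by rewrite integral_normal_cos -EFinM; congr EFin; ring.
  apply: measurable_bounded_integrable => //.
    by rewrite [X in (X < _)%E]probability_setT ltry.
  by exists 1; split => // M M1 u _; apply: le_trans (ltW M1); exact: cos_max.
rewrite /Rintegral => ->.
have mPh : measurable_fun [set: measurableTypeR R] (fun z => \int[P]_w (h (w, z))%:E)%E.
  exact: (measurable_fubini_G ih).
have hz' z : (`|\int[P]_w (h (w, z))%:E| <= (K * expR (- ((b * z) ^+ 2 / 2)))%:E)%E.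
  have fz : (\int[P]_w (h (w, z))%:E \is a fin_num)%E.
    apply: (integrable_fin_num measurableT).
    apply: measurable_bounded_integrable => //.
    - by rewrite [X in (X < _)%E]probability_setT ltry.
    - by apply: (measurableT_comp mh); exact: measurable_fun_pair.
    - by exists 1; split => // M M1 u _; apply: le_trans (h1 _) (ltW M1).
  by rewrite -(fineK fz) lee_fin; exact: hz.
have le : (`|\int[N]_z \int[P]_w (EFin \o h) (w, z)| <= (K / b)%:E)%E.
  apply: (le_trans (le_abse_integral _ measurableT _)); first exact: mPh.
  apply: (@le_trans _ _ (\int[N]_z (K%:E * (expR (- ((b * z) ^+ 2 / 2)))%:E))%E).
    apply: ge0_le_integral => //.
    - exact: measurableT_comp.
    - apply/measurable_EFinP; apply: measurable_funM; first exact: measurable_cst.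
      exact: measurable_gauss_weight.
    - by move=> z _; rewrite -EFinM; exact: hz'.
  rewrite ge0_integralZl_EFin//; last first.
    by apply/measurable_EFinP; exact: measurable_gauss_weight.
  by rewrite EFinM lee_wpmul2l// normal_gauss_weight_le.
set I := integral _ _ _ in le *.
have fI : I \is a fin_num by rewrite fin_num_abs (le_lt_trans le)// ltry.
by move: le; rewrite -{1}(fineK fI) lee_fin.
Qed.

(** The weights are introduced from the last variable to the first.  After k steps
    the integrand is the cosine of a combination of the first n - k variables,
    times the weights of the others, and [gaussian_weight_step] applied to the
    coefficient of variable n - k - 1 moves the latter from the cosine to the
    weights. *)
Lemma gaussian_small_ball (n : nat) (X : nat -> T -> R) (b : nat -> R) :
  (forall i, measurable_fun setT (X i)) -> (forall i, (i < n)%N -> 0 < b i) ->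
  (forall z : nat -> R, `|\int[P]_w (cos (\sum_(i < n) X i w * z i))| <=
     \prod_(i < n) expR (- ((b i * z i) ^+ 2 / 2)))%R ->
  (\int[P]_w (\prod_(i < n) expR (- (X i w ^+ 2 / 2)))%:E <=
    (\prod_(i < n) (b i)^-1)%:E)%E.
Proof.
move=> mX b0 hz.
pose G k w := \prod_(k <= i < n) expR (- (X i w ^+ 2 / 2)).
have mS k (z : nat -> R) : measurable_fun setT (fun w => \sum_(i < k) X i w * z i).
  by apply: measurable_sum => i; exact: measurable_funM.
have mE i : measurable_fun setT (fun w => expR (- (X i w ^+ 2 / 2))).
  apply: measurableT_comp => //; apply: measurableT_comp => //.
  by apply: measurable_funM => //; exact: measurable_funX.
have mG k : measurable_fun setT (G k) by exact: measurable_prod.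
have E01 i w : 0 <= expR (- (X i w ^+ 2 / 2)) <= 1.
  by rewrite expR_ge0/= -expR0 ler_expR oppr_le0 divr_ge0// sqr_ge0.
have G01 k w : 0 <= G k w <= 1.
  rewrite /G; elim/big_rec : _ => [|i x _ /andP[x0 x1]]; first by rewrite ler01 lexx.
  by have /andP[e0 e1] := E01 i w; rewrite mulr_ge0//= mulr_ile1.
have step k : (k <= n)%N -> forall z : nat -> R,
  (`|\int[P]_w (cos (\sum_(i < n - k) X i w * z i) * G (n - k)%N w)| <=
   \prod_(i < n - k) expR (- ((b i * z i) ^+ 2 / 2)) *
   \prod_(n - k <= i < n) (b i)^-1)%R.
  elim: k => [|k IH] kn z.
    rewrite subn0 [X in _ * X]big_geq// mulr1.
    rewrite (_ : \int[P]_w _ = \int[P]_w (cos (\sum_(i < n) X i w * z i)))%R ?hz//.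
    by apply: eq_Rintegral => w _; rewrite /G big_geq// mulr1.
  have {}IH := IH (ltnW kn).
  have nk : (n - k = (n - k.+1).+1)%N by rewrite subnSK.
  rewrite nk in IH; set m := (n - k.+1)%N in IH *.
  have mn : (m < n)%N by rewrite /m ltn_subrL (leq_ltn_trans _ kn).
  rewrite [X in _ * X]big_ltn// mulrA.
  have Gm w : G m w = expR (- (X m w ^+ 2 / 2)) * G m.+1 w by rewrite /G big_ltn.
  under eq_Rintegral do rewrite Gm.
  rewrite mulrAC.
  apply: (gaussian_weight_step (mX m) (mS m z) (mG m.+1) (G01 m.+1) (b0 m mn)) => x.
  (* the coefficient of variable m becomes the free parameter x *)
  have := IH (fun i => if i == m then x else z i).
  rewrite !big_ord_recr/= eqxx mulrAC.
  under [X in _ <= X * _ * _ -> _]eq_bigr => i _ do rewrite (ltn_eqF (ltn_ord i)).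
  apply: le_trans.
  rewrite le_eqVlt; apply/orP; left; apply/eqP; congr `| _ |.
  apply: eq_Rintegral => w _; rewrite big_ord_recr/= eqxx.
  by under [X in _ = cos (X + _) * _]eq_bigr => i _ do rewrite (ltn_eqF (ltn_ord i)).
have := step n (leqnn n) (fun=> 0).
rewrite subnn big_ord0 mul1r !big_mkord.
have -> : (\int[P]_w (cos (\sum_(i < 0) X i w * 0) * G 0 w) = \int[P]_w G 0%N w)%R.
  by apply: eq_Rintegral => w _; rewrite big_ord0 cos0 mul1r.
have fI : (\int[P]_w (G 0%N w)%:E \is a fin_num)%E.
  apply: (integrable_fin_num measurableT).
  apply: measurable_bounded_integrable => //.
    by rewrite [X in (X < _)%E]probability_setT ltry.
  exists 1; split => // M M1 w _; apply: le_trans (ltW M1).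
  by have /andP[g0 g1] := G01 0%N w; rewrite ger0_norm.
rewrite /Rintegral => h.
under eq_integral => w _ do rewrite -(big_mkord xpredT (fun i => expR (- (X i w ^+ 2 / 2)))).
by rewrite -(fineK fI) lee_fin (le_trans _ h)// ler_norm.
Qed.

End fourier.

(** * Integrals of powers *)

Section power_integrals.
Context (R : realType).
Local Notation mu := (@lebesgue_measure R).

Lemma integral_powR_itv (s a b : R) : 0 < a -> a < b -> s + 1 != 0 ->
  (\int[mu]_(x in [set` `[a, b]]) (x `^ s)%:E =
    ((b `^ (s + 1) - a `^ (s + 1)) / (s + 1))%:E)%E.
Proof.
move=> a0 ab s1; pose F x := (s + 1)^-1 * x `^ (s + 1).
have dF (x : R) : 0 < x -> is_derive x (1 : R) F (x `^ s).
  move=> x0; have dp := is_derive1_powR (s + 1) x0.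
  apply: is_derive_eq; rewrite /GRing.scale/= addrK.
  by rewrite mulKf.
have cpow (t x : R) : 0 < x -> {for x, continuous (fun y : R => y `^ t)}.
  move=> x0; have dp := is_derive1_powR t x0.
  by apply/differentiable_continuous/derivable1_diffP; case: dp.
have cF (x : R) : 0 < x -> {for x, continuous F}.
  by move=> x0; apply: cvgM; [exact: cvg_cst|exact: cpow].
rewrite (@continuous_FTC2 R (fun x => x `^ s) F)//.
- by rewrite -EFinB /F; congr EFin; ring.
- apply: continuous_in_subspaceT => x; rewrite inE/= in_itv/= => /andP[ax _].
  exact/cpow/(lt_le_trans a0).
- split.
  + move=> x; rewrite in_itv/= => /andP[ax _].
    by have := dF x (lt_trans a0 ax) => -[].
  + exact/cvg_at_right_filter/cF.
  + exact/cvg_at_left_filter/cF/(lt_trans a0).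
- move=> x; rewrite in_itv/= => /andP[ax _].
  by rewrite derive1E; have := dF x (lt_trans a0 ax) => dFx; rewrite derive_val.
Qed.

Lemma ge0_integral_bigcup_le (f : R -> \bar R) (F : nat -> set R) (C : \bar R) :
  (forall n m, (n <= m)%N -> F n `<=` F m) -> (forall n, measurable (F n)) ->
  measurable_fun setT f -> (forall x, 0 <= f x)%E ->
  (forall n, \int[mu]_(x in F n) f x <= C)%E ->
  (\int[mu]_(x in \bigcup_n F n) f x <= C)%E.
Proof.
move=> ndF mF mf f0 FC.
have homoF : {homo F : n m / (n <= m)%N >-> (n <= m)%O}.
  by move=> n m nm; apply/subsetPset; exact: ndF.
have := @ge0_nondecreasing_set_cvg_integral _ (measurableTypeR R) R F f mu homoF mF
  (fun i => measurable_funTS mf) (fun _ x _ => f0 x).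
move=> cv; rewrite -(cvg_lim _ cv)//; apply: lime_le; first by apply/cvg_ex; eexists; exact: cv.
exact: nearW.
Qed.

Lemma measurable_powR_EFin (s : R) : measurable_fun [set: R] (fun x : R => (x `^ s)%:E).
Proof. by apply/measurable_EFinP; exact: measurable_powR. Qed.

Lemma integral_powR_01_le (s : R) : -1 < s ->
  (\int[mu]_(x in [set` `]0%R, 1%R]]) (x `^ s)%:E <= ((s + 1)^-1)%:E)%E.
Proof.
move=> s1; have s10 : 0 < s + 1 by lra.
have -> : [set` `]0%R, 1%R] : interval R] = \bigcup_n [set` `[(n.+2%:R^-1 : R), 1%R]].
  apply/seteqP; split => x/=.
    rewrite in_itv/= => /andP[x0 x1]; exists (Num.truncn (x^-1)) => //=.
    rewrite in_itv/= x1 andbT invf_ple ?posrE ?ltr0n//.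
    by rewrite (le_trans (ltW (truncnS_gt _)))// ler_nat.
  move=> [n _ /=]; rewrite !in_itv/= => /andP[nx ->]; rewrite andbT.
  by rewrite (lt_le_trans _ nx)// invr_gt0 ltr0n.
apply: ge0_integral_bigcup_le.
- move=> n m nm x /=; rewrite !in_itv/= => /andP[nx ->]; rewrite andbT.
  by rewrite (le_trans _ nx)// lef_pV2 ?posrE ?ltr0n// ler_nat !ltnS.
- by move=> n; exact: measurable_itv.
- exact: measurable_powR_EFin.
- by move=> x; rewrite lee_fin powR_ge0.
move=> n; rewrite integral_powR_itv ?invr_gt0 ?ltr0n ?invf_lt1 ?ltr1n ?gt_eqF//.
by rewrite lee_fin powR1 ler_pdivrMr// mulVf ?gt_eqF// lerBlDr lerDl powR_ge0.
Qed.

Lemma integral_powR_1y_le (s : R) : s < -1 ->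
  (\int[mu]_(x in [set` `[1%R, +oo[]) (x `^ s)%:E <= (- (s + 1)^-1)%:E)%E.
Proof.
move=> s1; have s10 : s + 1 < 0 by lra.
have -> : [set` `[1%R, +oo[ : interval R] = \bigcup_n [set` `[1%R, (n.+2%:R : R)]].
  apply/seteqP; split => x/=.
    rewrite in_itv/= andbT => x1; exists (Num.truncn x) => //=.
    rewrite in_itv/= x1/=.
    by rewrite (le_trans (ltW (truncnS_gt _)))// ler_nat.
  by move=> [n _ /=]; rewrite !in_itv/= => /andP[->].
apply: ge0_integral_bigcup_le.
- move=> n m nm x /=; rewrite !in_itv/= => /andP[-> nx]/=.
  by rewrite (le_trans nx)// ler_nat !ltnS.
- by move=> n; exact: measurable_itv.
- exact: measurable_powR_EFin.
- by move=> x; rewrite lee_fin powR_ge0.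
move=> n; rewrite integral_powR_itv ?ltr1n ?lt_eqF//.
by rewrite lee_fin powR1 ler_ndivrMr// mulNr mulVf ?lt_eqF// lerBrDl addrN powR_ge0.
Qed.

End power_integrals.

(** * The moving-average kernel *)

Section moving_average.
Context (R : realType) (alpha : R) (alpha_gt0 : 0 < alpha) (alpha_lt1 : alpha < 1).
Local Notation mu := (@lebesgue_measure R).
Local Notation p := (alpha - 2^-1).

(** The kernel, restricted to positive arguments, of the moving-average
    representation of fractional Brownian motion.  It is used only
    through the L^2 geometry of its translates, in which a later translate has mass
    where all earlier ones vanish. *)
Definition ma_kernel (x : R) : R := if 0 < x then x `^ p else 0.
Local Notation h := ma_kernel.

Lemma measurable_ma_kernel : measurable_fun [set: R] h.
Proof.
apply: measurable_fun_ifT.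
- by apply: measurable_fun_ltr; [exact: measurable_cst|exact: measurable_id].
- exact: measurable_powR.
- exact: measurable_cst.
Qed.

Lemma powR_sqr (x q : R) : (x `^ q) ^+ 2 = x `^ (2 * q).
Proof. by rewrite mulrC powRrM powR_mulrn// powR_ge0. Qed.

Lemma integral_if_itv (i : interval R) (f : R -> R) :
  (\int[mu]_x (if x \in i then f x else 0)%:E = \int[mu]_(x in [set` i]) (f x)%:E)%E.
Proof.
rewrite [RHS]integral_mkcond; apply: eq_integral => x _.
by rewrite patchE mem_setE; case: ifP.
Qed.

Lemma powR_1D_sub1_le (y q : R) : 0 <= y -> -1 <= q <= 1 -> `|(1 + y) `^ q - 1| <= y.
Proof.
move=> y0 /andP[q1 q2]; have y1 : 1 <= 1 + y by rewrite lerDl.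
have le : (1 + y) `^ q <= 1 + y by rewrite ler1_powR.
have ge : (1 + y)^-1 <= (1 + y) `^ q.
  by rewrite -powR_inv1 ?ler_powR// addr_ge0.
have : 1 - y <= (1 + y)^-1.
  by rewrite -div1r ler_pdivlMr ?(lt_le_trans ltr01)//; nra.
rewrite ler_norml => ?; apply/andP; split; lra.
Qed.

(** The increment of the kernel over a unit step has a singularity of exponent
    2 alpha - 1 > -1 at -1 and at 0, while at infinity the bound
    |(1 + 1/x)^p - 1| <= 1/x gives a decay of exponent 2 alpha - 3 < -1. *)
Lemma ma_kernel_increment_le (x : R) :
  (h (x + 1) - h x) ^+ 2 <=
    2 * (if (x + 1) \in `]0, 1] then (x + 1) `^ (2 * p) else 0) +
    2 * (if x \in `]0, 1] then x `^ (2 * p) else 0) +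
    (if x \in `]0, 1] then 4 else 0) +
    (if x \in `[1, +oo[ then x `^ (2 * p - 2) else 0).
Proof.
have [a0 a1] : 0 < alpha /\ alpha < 1 by [].
have p1 : -1 <= p <= 1 by apply/andP; split; lra.
have pow0 (y q : R) : 0 <= y `^ q by exact: powR_ge0.
have [x1|x1] := leP x (-1).
  rewrite /h !ltNge (le_trans x1) ?ltrN10 ?lerN10//= (_ : x + 1 <= 0)/=; last lra.
  rewrite subrr expr0n/=; repeat case: ifP => _;
    by rewrite ?mulr0 ?addr0 ?add0r ?addr_ge0 ?mulr_ge0.
have [x0|x0] := leP x 0.
  have x10 : 0 < x + 1 by lra.
  have x11 : x + 1 <= 1 by lra.
  have x1N : (1 <= x) = false by apply/negbTE; rewrite -ltNge; lra.
  have x0N : (0 < x) = false by apply/negbTE; rewrite -leNgt.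
  rewrite !in_itv/= /h x10 x11 x1N x0N/=.
  by rewrite subr0 mulr0 !addr0 powR_sqr ler_peMl// ler1n.
have x10 : 0 < x + 1 by lra.
rewrite /h x0 x10 !in_itv/= x0 x10/= andbT.
have [xle1|xgt1] := leP x 1.
  have -> : (x + 1 <= 1) = false by apply/negbTE; rewrite -ltNge; lra.
  have : (x + 1) `^ (2 * p) <= 2.
    apply: (@le_trans _ _ (x + 1)); last lra.
    by apply: ler1_powR; [lra|lra].
  rewrite -!powR_sqr; set a := (x + 1) `^ p; set b := x `^ p => ab.
  set c := (X in _ <= _ + X); have c0 : 0 <= c by rewrite /c; case: ifP.
  have := sqr_ge0 (a + b); rewrite sqrrD sqrrB mulr0 add0r; lra.
have -> : (x + 1 <= 1) = false by apply/negbTE; rewrite -ltNge; lra.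
rewrite (ltW xgt1) !mulr0 !add0r.
have -> : x + 1 = x * (1 + x^-1) by rewrite mulrDr mulr1 divff ?gt_eqF.
rewrite powRM; [|exact: ltW|by rewrite addr_ge0 ?invr_ge0 ?(ltW x0)].
rewrite -[X in _ - X]mulr1 -mulrBr exprMn powR_sqr.
have -> : x `^ (2 * p - 2) = x `^ (2 * p) * x ^- 2.
  have -> : x ^- 2 = x `^ (- 2%:R) by rewrite powRN powR_mulrn// ltW.
  by rewrite -powRD// (gt_eqF x0) implybT.
rewrite ler_wpM2l// -exprVn -[leLHS]real_normK ?num_real//.
by rewrite lerXn2r ?nnegrE ?invr_ge0 ?(ltW x0)// powR_1D_sub1_le// invr_ge0 ltW.
Qed.

Lemma measurable_if_itv (i : interval R) (f : R -> R) : measurable_fun setT f ->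
  measurable_fun [set: R] (fun x => if x \in i then f x else 0).
Proof.
move=> mf; rewrite (_ : (fun _ => _) = (f \_ [set` i])); last first.
  by apply/funext => x; rewrite patchE mem_setE.
by apply/(measurable_restrictT f) => //; exact: measurable_funTS.
Qed.

Lemma ma_kernel_increment_lty :
  (\int[mu]_x ((h (x + 1) - h x) ^+ 2)%:E < +oo)%E.
Proof.
have [a0 a1] : 0 < alpha /\ alpha < 1 by [].
have m1 : measurable_fun [set: R] (fun x : R => x + 1) by exact: measurable_funD.
(* the class of functions of finite integral is closed under sums and contains
   the four terms of the majorant *)
pose fi (f : R -> R) := [/\ measurable_fun [set: measurableTypeR R] f, forall x, 0 <= f x &
  (\int[mu]_x (f x)%:E < +oo)%E].
have fiD f g : fi f -> fi g -> fi (fun x => f x + g x).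
  move=> [mf f0 fy] [mg g0 gy]; split.
  - exact: measurable_funD.
  - by move=> x; exact: addr_ge0.
  - under eq_integral do rewrite EFinD.
    rewrite ge0_integralD//; try exact/measurable_EFinP; try by move=> x _; rewrite lee_fin.
    exact: lte_add_pinfty.
have fiZ f : fi f -> fi (fun x => 2 * f x).
  move=> ff; have := fiD f f ff ff; congr (fi _).
  by apply/funext => x; rewrite mulr_natl mulr2n.
pose g0 (x : R) := if x \in `]0, 1] then x `^ (2 * p) else 0.
pose g1 (x : R) := if x \in `[1, +oo[ then x `^ (2 * p - 2) else 0.
pose gc (x : R) : R := if x \in `]0, 1] then 4 else 0.
have fg0 : fi g0.
  split.
  - by apply: measurable_if_itv; exact: measurable_powR.
  - by move=> x; rewrite /g0; case: ifP => // _; exact: powR_ge0.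
  - rewrite integral_if_itv (le_lt_trans (integral_powR_01_le _)) ?ltry//; lra.
have fg1 : fi g1.
  split.
  - by apply: measurable_if_itv; exact: measurable_powR.
  - by move=> x; rewrite /g1; case: ifP => // _; exact: powR_ge0.
  - rewrite integral_if_itv (le_lt_trans (integral_powR_1y_le _)) ?ltry//; lra.
have fgc : fi gc.
  split.
  - by apply: measurable_if_itv; exact: measurable_cst.
  - by move=> x; rewrite /gc; case: ifP.
  - rewrite integral_if_itv integral_cst//= lebesgue_measure_itv/= lte_fin ltr01.
    by rewrite -EFinB -EFinM ltry.
have fg01 : fi (fun x => g0 (x + 1)).
  have [mg g00 gy] := fg0; split.
  - exact: (measurableT_comp mg).
  - by move=> x; exact: g00.
  - move: gy; rewrite (ge0_integral_affine 1 (@ltr01 R)); last 2 first.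
    + exact/measurable_EFinP.
    + by move=> x; rewrite lee_fin.
    by rewrite mul1e; under eq_integral do rewrite mul1r.
have [mD D0 Dy] := fiD _ _ (fiD _ _ (fiD _ _ (fiZ _ fg01) (fiZ _ fg0)) fgc) fg1.
apply: le_lt_trans Dy; apply: ge0_le_integral => //.
- by move=> x _; rewrite lee_fin sqr_ge0.
- apply/measurable_EFinP; apply: measurable_funX; apply: measurable_funB.
    exact: (measurableT_comp measurable_ma_kernel).
  exact: measurable_ma_kernel.
- exact/measurable_EFinP.
- by move=> x _; rewrite lee_fin; exact: ma_kernel_increment_le.
Qed.

Definition ma_const : R := fine (\int[mu]_x ((h (x + 1) - h x) ^+ 2)%:E).

Let ma_kernel_isometry_lt (t u : R) : u < t ->
  (\int[mu]_x ((h (t + x) - h (u + x)) ^+ 2)%:E =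
   (ma_const * `|t - u| `^ (2 * alpha))%:E)%E.
Proof.
move=> ut; pose d := t - u; have d0 : 0 < d by rewrite subr_gt0.
have mh := measurable_ma_kernel.
have mD (v : R) : measurable_fun [set: R] (fun x => h (v + x)).
  by apply: (measurableT_comp mh); exact: measurable_funD.
rewrite (ge0_integral_affine (- u) d0); last 2 first.
- by apply/measurable_EFinP; apply: measurable_funX; exact: measurable_funB.
- by move=> x; rewrite lee_fin sqr_ge0.
have hM (x : R) : h (d * x) = d `^ p * h x.
  rewrite /h pmulr_rgt0//; case: ifP => x0; last by rewrite mulr0.
  by rewrite powRM// ltW.
transitivity (d%:E * \int[mu]_x ((d `^ (2 * p))%:E * ((h (x + 1) - h x) ^+ 2)%:E))%E.
  congr (_ * _)%E; apply: eq_integral => x _; rewrite -EFinM; congr EFin.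
  rewrite (_ : t + (d * x - u) = d * (x + 1)); last by rewrite /d; ring.
  rewrite (_ : u + (d * x - u) = d * x); last by ring.
  by rewrite !hM -mulrBr exprMn powR_sqr.
rewrite ge0_integralZl_EFin ?powR_ge0//; last 2 first.
- by move=> x _; rewrite lee_fin sqr_ge0.
- apply/measurable_EFinP; apply: measurable_funX; apply: measurable_funB => //.
  by apply: (measurableT_comp mh); exact: measurable_funD.
rewrite muleA -EFinM -[X in (_ * X)%E]fineK; last first.
  rewrite ge0_fin_numE ?ma_kernel_increment_lty//.
  by apply: integral_ge0 => x _; rewrite lee_fin sqr_ge0.
rewrite -EFinM mulrC; congr (_ * _)%:E.
rewrite gtr0_norm// -/d (_ : 2 * alpha = 1 + 2 * p); last by field.
by rewrite powRD ?(gt_eqF d0) ?implybT// powRr1 ?(ltW d0).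
Qed.

(** Substituting x := d x - u, with d = t - u, leaves the unit increment at scale d,
    and the kernel is homogeneous: h (d x) = d^p h x with 2 p + 1 = 2 alpha. *)
Lemma ma_kernel_isometry (t u : R) :
  (\int[mu]_x ((h (t + x) - h (u + x)) ^+ 2)%:E =
   (ma_const * `|t - u| `^ (2 * alpha))%:E)%E.
Proof.
have [tu|ut|->] := ltgtP t u; last 1 first.
- rewrite subrr normr0 powR0 ?mulr0; last by rewrite mulf_neq0 ?gt_eqF.
  by rewrite (eq_integral (cst 0%E)) ?integral0// => x _; rewrite subrr expr0n.
- rewrite distrC -(ma_kernel_isometry_lt tu); apply: eq_integral => x _.
  by rewrite -sqrrN opprB.
- exact: ma_kernel_isometry_lt.
Qed.

End moving_average.

(** * Mean squares of combinations of increments *)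

Section increments.
Context (R : realType) (alpha : R).

(** The covariance of B(t_(i+1)) - B(t_i) and B(t_(k+1)) - B(t_k), obtained by
    polarising the variogram |t - u|^(2 alpha). *)
Definition increment_cov (t : nat -> R) (i k : nat) : R :=
  2^-1 * (`|t i.+1 - t k| `^ (2 * alpha) + `|t i - t k.+1| `^ (2 * alpha)
    - `|t i.+1 - t k.+1| `^ (2 * alpha) - `|t i - t k| `^ (2 * alpha)).

Definition increment_var (n : nat) (t z : nat -> R) : R :=
  \sum_(i < n) \sum_(k < n) z i * z k * increment_cov t i k.

Context d (S : measurableType d) (m : {measure set S -> \bar R}).

Lemma Rintegral_lincomb (J : Type) (s : seq J) (c : J -> R) (g : J -> S -> R) :
  (forall j, m.-integrable setT (EFin \o g j)) ->
  m.-integrable setT (EFin \o (fun w => \sum_(j <- s) c j * g j w)) /\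
  (\int[m]_w (\sum_(j <- s) c j * g j w) = \sum_(j <- s) c j * \int[m]_w g j w)%R.
Proof.
move=> ig; elim: s => [|j s [is_ IH]].
  rewrite big_nil; split.
    apply: (eq_integrable measurableT (cst 0%E)); last exact: integrable0.
    by move=> w _; rewrite /= big_nil.
  under eq_Rintegral do rewrite big_nil.
  by rewrite /Rintegral integral0.
pose u w := c j * g j w; pose v w := \sum_(j <- s) c j * g j w.
have icj : m.-integrable setT (EFin \o u).
  rewrite /comp /u; under eq_fun do rewrite EFinM.
  by apply: integrableZl => //; exact: ig.
split.
  apply: (eq_integrable measurableT ((EFin \o u) \+ (EFin \o v))%E).
    by move=> w _; rewrite /= big_cons.
  exact: integrableD.
under eq_Rintegral do rewrite big_cons.
by rewrite RintegralD// RintegralZl// IH big_cons.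
Qed.

(** The product of two increments is a combination of four squared differences
    F_i - F_k, so the mean square of a combination of increments depends on the
    variogram of F only.  The measure is arbitrary: with a probability it computes
    the variance of increments of B, and with Lebesgue measure the L^2 norm of
    increments of the kernel, so that the two agree up to the factor kappa. *)
Lemma integral_sqr_increments (kappa : R) (n : nat) (t z : nat -> R) (F : nat -> S -> R) :
  (forall i, measurable_fun setT (F i)) ->
  (forall i k, (i <= n)%N -> (k <= n)%N ->
    \int[m]_w ((F i w - F k w) ^+ 2)%:E = (kappa * `|t i - t k| `^ (2 * alpha))%:E)%E ->
  (\int[m]_w ((\sum_(i < n) z i * (F i.+1 w - F i w)) ^+ 2)%:E =
    (kappa * increment_var n t z)%:E)%E.
Proof.
move=> mF hF.
have ig i k : (i <= n)%N -> (k <= n)%N ->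
    m.-integrable setT (EFin \o (fun w => (F i w - F k w) ^+ 2)).
  move=> ni nk; apply/integrableP; split.
    by apply/measurable_EFinP; apply: measurable_funX; exact: measurable_funB.
  rewrite (eq_integral (fun w => ((F i w - F k w) ^+ 2)%:E)); last first.
    by move=> w _ /=; rewrite ger0_norm// sqr_ge0.
  by rewrite hF// ltry.
have Ig i k : (i <= n)%N -> (k <= n)%N ->
    (\int[m]_w ((F i w - F k w) ^+ 2) = kappa * `|t i - t k| `^ (2 * alpha))%R.
  by move=> ni nk; rewrite /Rintegral hF.
have prodE (i k : nat) w : (F i.+1 w - F i w) * (F k.+1 w - F k w) =
   \sum_(j <- [:: (1, (i.+1, k)); (1, (i, k.+1)); (-1, (i.+1, k.+1)); (-1, (i, k))])
     (2^-1 * j.1) * (F j.2.1 w - F j.2.2 w) ^+ 2.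
  by rewrite !big_cons big_nil/=; field.
have [prodi prodI] : (forall i k : nat, (i < n)%N -> (k < n)%N ->
    m.-integrable setT (EFin \o (fun w => (F i.+1 w - F i w) * (F k.+1 w - F k w)))) /\
  (forall i k : nat, (i < n)%N -> (k < n)%N ->
    (\int[m]_w ((F i.+1 w - F i w) * (F k.+1 w - F k w)) = kappa * increment_cov t i k)%R).
  pose gg (j : R * (nat * nat)) w :=
    if (j.2.1 <= n)%N && (j.2.2 <= n)%N then (F j.2.1 w - F j.2.2 w) ^+ 2 else 0.
  have igg j : m.-integrable setT (EFin \o gg j).
    case c : ((j.2.1 <= n)%N && (j.2.2 <= n)%N).
      have /andP[h1 h2] := c; apply: eq_integrable (ig _ _ h1 h2) => // w _.
      by rewrite /gg /= c.
    by apply: eq_integrable (integrable0 m setT) => // w _; rewrite /gg /= c.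
  have prodE' (i k : nat) : (i < n)%N -> (k < n)%N ->
    (fun w => (F i.+1 w - F i w) * (F k.+1 w - F k w)) =
    (fun w => \sum_(j <- [:: (1, (i.+1, k)); (1, (i, k.+1)); (-1, (i.+1, k.+1)); (-1, (i, k))])
     (2^-1 * j.1) * gg j w).
    move=> ni nk; apply/funext => w; rewrite prodE !big_cons !big_nil /gg/=.
    by rewrite ni nk !(ltnW ni) !(ltnW nk).
  split=> i k ni nk; rewrite prodE'//; have [A B] := Rintegral_lincomb
    [:: (1, (i.+1, k)); (1, (i, k.+1)); (-1, (i.+1, k.+1)); (-1, (i, k))]
    (fun j => 2^-1 * j.1) igg; first exact: A.
  rewrite B !big_cons big_nil /gg/= ni nk !(ltnW ni) !(ltnW nk)/= !Ig// ?(ltnW ni) ?(ltnW nk)//.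
  by rewrite /increment_cov; ring.
have sqrE w : (\sum_(i < n) z i * (F i.+1 w - F i w)) ^+ 2 =
  \sum_(i < n) z i * (\sum_(k < n) z k * ((F i.+1 w - F i w) * (F k.+1 w - F k w))).
  rewrite expr2 big_distrl/=; apply: eq_bigr => i _.
  by rewrite -mulrA; congr (_ * _); rewrite big_distrr/=; apply: eq_bigr => k _; ring.
have inner (i : 'I_n) := Rintegral_lincomb (index_enum 'I_n) z
  (fun k : 'I_n => prodi i k (ltn_ord i) (ltn_ord k)).
have [A B] := Rintegral_lincomb (index_enum 'I_n) z (fun i => (inner i).1).
have E : (\int[m]_w ((\sum_(i < n) z i * (F i.+1 w - F i w)) ^+ 2) =
    kappa * increment_var n t z)%R.
  under eq_Rintegral do rewrite sqrE.
  rewrite B /increment_var mulr_sumr; apply: eq_bigr => i _.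
  rewrite (inner i).2 !mulr_sumr; apply: eq_bigr => k _.
  by rewrite prodI//; ring.
rewrite -E /Rintegral fineK//; apply: (integrable_fin_num measurableT).
by apply: eq_integrable A => // w _ /=; rewrite sqrE.
Qed.

End increments.

(** * Local nondeterminism *)

Section local_nondeterminism.
Context (R : realType) (alpha : R) (alpha_gt0 : 0 < alpha) (alpha_lt1 : alpha < 1).
Local Notation mu := (@lebesgue_measure R).
Local Notation p := (alpha - 2^-1).
Local Notation h := (ma_kernel alpha).
Local Notation kappa := (ma_const alpha).
Local Notation var := (increment_var alpha).

Let measurable_h (v : R) : measurable_fun [set: R] (fun x => h (v + x)).
Proof.
by apply: (measurableT_comp (measurable_ma_kernel alpha)); exact: measurable_funD.
Qed.

Let integral_ma_increments n (t z : nat -> R) :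
  (\int[mu]_x ((\sum_(i < n) z i * (h (t i.+1 + x) - h (t i + x))) ^+ 2)%:E =
    (kappa * var n t z)%:E)%E.
Proof.
apply: (@integral_sqr_increments R alpha _ _ mu kappa n t z (fun i x => h (t i + x))).
- by move=> i; exact: measurable_h.
- by move=> i k _ _; exact: ma_kernel_isometry.
Qed.

Let measurable_ma_increments n (t z : nat -> R) : measurable_fun [set: measurableTypeR R]
  (fun x : R => (\sum_(i < n) z i * (h (t i.+1 + x) - h (t i + x))) ^+ 2).
Proof.
apply: measurable_funX; apply: measurable_sum => i; apply: measurable_funM => //.
by apply: measurable_funB; exact: measurable_h.
Qed.

Let measurable_increment (u v : R) : measurable_fun [set: measurableTypeR R]
  (fun x : R => (h (u + x) - h (v + x)) ^+ 2).
Proof. by apply: measurable_funX; apply: measurable_funB; exact: measurable_h. Qed.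

(** By [integral_sqr_increments] the right-hand side is the squared L^2 norm of a
    combination of kernel increments.  For x with d/2 <= t_(n+1) + x < d, where
    d = t_(n+1) - t_n, the arguments of all the other kernels are negative; only
    h(t_(n+1) + x) survives, with square at least d^(2 p) / 2, on an interval of
    length d/2. *)
Lemma last_increment_var_ge n (t z : nat -> R) :
  (forall i, (i <= n)%N -> t i <= t n) -> t n < t n.+1 ->
  z n ^+ 2 * (t n.+1 - t n) `^ (2 * alpha) / 4 <= kappa * var n.+1 t z.
Proof.
move=> tn tn1; set d := t n.+1 - t n; have d0 : 0 < d by rewrite subr_gt0.
have [a0 a1] : 0 < alpha /\ alpha < 1 by [].
rewrite -lee_fin -integral_ma_increments.
pose J : interval R := `[d / 2 - t n.+1, d - t n.+1[.
pose c := z n ^+ 2 * (d `^ (2 * p) / 2).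
apply: (@le_trans _ _ (\int[mu]_(x in [set` J]) c%:E)%E).
  rewrite integral_cst//= lebesgue_measure_itv/= lte_fin ltrD2r.
  rewrite ltr_pdivrMr// ltr_pMr// ltr1n -EFinB -EFinM lee_fin.
  rewrite /c (_ : 2 * alpha = 1 + 2 * p); last by field.
  rewrite powRD ?(gt_eqF d0) ?implybT// powRr1 ?(ltW d0)//.
  by rewrite le_eqVlt; apply/orP; left; apply/eqP; field.
apply: (@le_trans _ _ (\int[mu]_(x in [set` J])
    ((\sum_(i < n.+1) z i * (h (t i.+1 + x) - h (t i + x))) ^+ 2)%:E)%E).
  apply: ge0_le_integral => //.
  - by move=> x _; rewrite lee_fin /c mulr_ge0 ?sqr_ge0// divr_ge0// powR_ge0.
  - by apply/measurable_EFinP; apply: measurable_funTS; exact: measurable_ma_increments.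
  move=> x; rewrite /J /= in_itv/= => /andP[x1 x2]; rewrite lee_fin.
  have hi i : (i <= n)%N -> h (t i + x) = 0.
    move=> ni; rewrite /ma_kernel ifF//; apply/negbTE; rewrite -leNgt.
    have := tn i ni; rewrite /d in x2; lra.
  rewrite big_ord_recr/= big1 => [|i _]; last first.
    by rewrite (hi i (ltnW (ltn_ord i))) (hi i.+1 (ltn_ord i)) subrr mulr0.
  rewrite add0r (hi n)// subr0 exprMn /c ler_wpM2l ?sqr_ge0//.
  have y0 : 0 < t n.+1 + x by rewrite (lt_le_trans _ (_ : d / 2 <= _)) ?divr_gt0//; lra.
  rewrite /ma_kernel y0 powR_sqr.
  set y := t n.+1 + x in y0 *.
  have -> : y = d * (y / d) by rewrite mulrC divfK ?gt_eqF.
  have u0 : 0 < y / d by rewrite divr_gt0.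
  rewrite powRM ?(ltW d0) ?(ltW u0)// ler_wpM2l ?powR_ge0//.
  have ge1 : 2^-1 <= y / d by rewrite ler_pdivlMr// /y; lra.
  (* u <= u ^ (2 p) on ]0, 1] since 2 p <= 1 *)
  apply: (le_trans ge1); apply: ger1_powR; last lra.
  by rewrite u0/= ler_pdivrMr// mul1r /y; lra.
apply: ge0_subset_integral => //.
- by apply/measurable_EFinP; exact: measurable_ma_increments.
- by move=> x _; rewrite lee_fin sqr_ge0.
Qed.

Lemma ma_const_gt0 : 0 < kappa.
Proof.
pose t (i : nat) : R := i%:R.
have := @last_increment_var_ge 0 t (fun=> 1).
have -> : var 1 t (fun=> 1) = 1.
  rewrite /increment_var !big_ord1 /increment_cov /t !subrr normr0.
  rewrite sub0r subr0 normrN normr1 powR1 powR0; last by rewrite mulf_neq0 ?gt_eqF.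
  by field.
rewrite /t subr0 powR1 expr1n !mulr1 => h4; apply: (lt_le_trans _ (h4 _ _)) => //.
by move=> i; rewrite leqn0 => /eqP ->.
Qed.

(** Dropping the last increment changes the L^2 norm by at most the norm of the last
    increment, whose square z_n^2 kappa d^(2 alpha) is, by [last_increment_var_ge],
    bounded by a multiple of the variance itself. *)
Lemma increment_var_recr_le n (t z : nat -> R) :
  (forall i, (i <= n)%N -> t i <= t n) -> t n < t n.+1 ->
  var n t z <= (2 + 8 * kappa) * var n.+1 t z.
Proof.
move=> tn tn1; set d := t n.+1 - t n; have d0 : 0 < d by rewrite subr_gt0.
have k0 := ma_const_gt0.
have v_last := last_increment_var_ge z tn tn1; rewrite -/d in v_last.
have : kappa * var n t z <= 2 * (kappa * var n.+1 t z) +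
    2 * z n ^+ 2 * (kappa * d `^ (2 * alpha)).
  rewrite -lee_fin -integral_ma_increments EFinD [X in (_ <= X + _)%E]EFinM.
  rewrite -integral_ma_increments -[d in X in (_ <= _ + X)%E]gtr0_norm//.
  rewrite [X in (_ <= _ + X)%E]EFinM -ma_kernel_isometry//.
  rewrite -!ge0_integralZl_EFin//; last 5 first.
  - by move=> x _; rewrite lee_fin sqr_ge0.
  - by apply/measurable_EFinP; exact: measurable_increment.
  - by rewrite mulr_ge0// sqr_ge0.
  - by move=> x _; rewrite lee_fin sqr_ge0.
  - by apply/measurable_EFinP; exact: measurable_ma_increments.
  rewrite -ge0_integralD//; last 4 first.
  - by move=> x _; rewrite -EFinM lee_fin mulr_ge0 ?sqr_ge0.
  - by apply/measurable_EFinP; apply: measurable_funM => //; exact: measurable_ma_increments.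
  - by move=> x _; rewrite -EFinM lee_fin mulr_ge0 ?sqr_ge0// mulr_ge0 ?sqr_ge0.
  - by apply/measurable_EFinP; apply: measurable_funM => //; exact: measurable_increment.
  apply: ge0_le_integral => //.
  - by move=> x _; rewrite lee_fin sqr_ge0.
  - by apply/measurable_EFinP; exact: measurable_ma_increments.
  - apply/measurable_EFinP; apply: measurable_funD.
      by apply: measurable_funM => //; exact: measurable_ma_increments.
    by apply: measurable_funM => //; exact: measurable_increment.
  move=> x _; rewrite -!EFinM -EFinD lee_fin big_ord_recr/=.
  set a := \sum_(_ < _) _; set b := h _ - h _.
  by rewrite -subr_ge0 (_ : _ - _ = (a + 2 * (z n * b)) ^+ 2) ?sqr_ge0//; ring.
nra.
Qed.

(** Half of the variance pays for the last increment, by [last_increment_var_ge],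
    and the other half for the earlier ones, by induction and
    [increment_var_recr_le].  The constant depends on the number of increments but
    not on the times. *)
Lemma local_nondeterminism n : exists2 c : R, 0 < c & forall t z : nat -> R,
  (forall i, (i < n)%N -> t i < t i.+1) ->
  c * (\sum_(i < n) z i ^+ 2 * (t i.+1 - t i) `^ (2 * alpha)) <= var n t z.
Proof.
have k0 := ma_const_gt0.
elim: n => [|n [c c0 IH]].
  by exists 1 => // t z _; rewrite /increment_var !big_ord0 mulr0.
pose L := 2 * (2 + 8 * kappa); have L0 : 0 < L by rewrite /L; lra.
exists (Num.min (c / L) (8 * kappa)^-1).
  by rewrite lt_min divr_gt0//= invr_gt0 mulr_gt0.
move=> t z tinc.
have tle m : (m <= n)%N -> forall i, (i <= m)%N -> t i <= t m.
  elim: m => [_ i|m IHm mn i]; first by rewrite leqn0 => /eqP ->.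
  rewrite leq_eqVlt => /predU1P[-> //|]; rewrite ltnS => im.
  by rewrite (le_trans (IHm (ltnW mn) i im))// ltW// tinc// ltnW.
have IHn := IH t z (fun i ni => tinc i (ltnW ni)).
have v1 := increment_var_recr_le z (tle n (leqnn n)) (tinc n (ltnSn n)).
have v2 := last_increment_var_ge z (tle n (leqnn n)) (tinc n (ltnSn n)).
rewrite big_ord_recr/= mulrDr.
set s := \sum_(_ < _) _ in IHn *; set q := z n ^+ 2 * _ in v2 *.
have s0 : 0 <= s by apply: sumr_ge0 => i _; rewrite mulr_ge0 ?sqr_ge0 ?powR_ge0.
have q0 : 0 <= q by rewrite mulr_ge0 ?sqr_ge0 ?powR_ge0.
set V := var n.+1 t z in v1 v2 *.
have e1 : Num.min (c / L) (8 * kappa)^-1 * s <= V / 2.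
  apply: (@le_trans _ _ (c / L * s)); first by rewrite ler_wpM2r// ge_min lexx.
  by rewrite mulrAC ler_pdivrMr// /L; nra.
have e2 : Num.min (c / L) (8 * kappa)^-1 * q <= V / 2.
  apply: (@le_trans _ _ ((8 * kappa)^-1 * q)).
    by rewrite ler_wpM2r// ge_min lexx orbT.
  by rewrite mulrC ler_pdivrMr ?mulr_gt0//; nra.
by rewrite (le_trans (lerD e1 e2))//; lra.
Qed.

End local_nondeterminism.

(** * Gaussian laws *)

Section laws.
Context (R : realType).
Local Notation N := (normal_prob (0 : R) 1).

Lemma ge0_integral_eq_law d d' (T : measurableType d) (T' : measurableType d')
    (m : {measure set T -> \bar R}) (nu : {measure set T' -> \bar R})
    (X : T -> T') (f : T' -> \bar R) :
  measurable_fun setT X -> eq_law (pushforward m X) nu ->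
  measurable_fun setT f -> (forall x, 0 <= f x)%E ->
  (\int[m]_w f (X w) = \int[nu]_x f x)%E.
Proof.
move=> mX XE mf f0.
transitivity (\int[pushforward m X]_x f x)%E.
  by rewrite ge0_integral_pushforward ?preimage_setT.
by apply: eq_measure_integral => A mA _; exact: XE.
Qed.

Lemma integral_eq_law d d' (T : measurableType d) (T' : measurableType d')
    (m : {measure set T -> \bar R}) (nu : {measure set T' -> \bar R})
    (X : T -> T') (f : T' -> R) :
  measurable_fun setT X -> eq_law (pushforward m X) nu ->
  measurable_fun setT f -> (\int[m]_w (f (X w))%:E = \int[nu]_x (f x)%:E)%E.
Proof.
move=> mX XE mf; rewrite [LHS]integralE [RHS]integralE.
have mf' : measurable_fun setT (EFin \o f) by exact/measurable_EFinP.
rewrite -(ge0_integral_eq_law mX XE (measurable_funepos mf'))//.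
rewrite -(ge0_integral_eq_law mX XE (measurable_funeneg mf'))//.
by congr (_ - _)%E; apply: eq_integral => w _; rewrite ?funeposE ?funenegE.
Qed.

Lemma eq_law_normal_affine (m s : R) : 0 < s ->
  eq_law (pushforward N (fun z : measurableTypeR R => (s * z + m : measurableTypeR R)))
    (normal_prob m s).
Proof.
move=> s0 A mA; rewrite /pushforward.
have ma : measurable_fun setT (fun z : measurableTypeR R => (s * z + m : measurableTypeR R)).
  by apply: measurable_funD => //; exact: measurable_funM.
have mpA : measurable ((fun z : measurableTypeR R => (s * z + m : measurableTypeR R)) @^-1` A).
  by rewrite -[X in measurable X]setTI; exact: ma.
transitivity (\int[normal_prob m s]_x (\1_A x)%:E)%E; last by rewrite integral_indic// setIT.
rewrite ge0_integral_normal_standard//; last by apply/measurable_EFinP; exact: measurable_indic.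
by rewrite -[X in normal_prob _ _ X = _]setIT -integral_indic.
Qed.

Lemma integral_normal_standard (m s : R) (f : R -> R) : 0 < s ->
  measurable_fun setT f ->
  (\int[normal_prob m s]_x (f x)%:E = \int[N]_z (f (s * z + m))%:E)%E.
Proof.
move=> s0 mf; apply/esym.
have ma : measurable_fun setT (fun z : measurableTypeR R => (s * z + m : measurableTypeR R)).
  by apply: measurable_funD => //; exact: measurable_funM.
exact: (@integral_eq_law _ _ (measurableTypeR R) (measurableTypeR R) N (normal_prob m s)
  (fun z => s * z + m) f ma (eq_law_normal_affine m s0) mf).
Qed.

Lemma integral_normal_affine (m s : R) : (\int[N]_z (s * z + m)%:E = m%:E)%E.
Proof.
rewrite integral_normal_prob; last by apply: measurable_funD => //; exact: measurable_funM.
have i0 := integrable_normal_pdf (0 : R) 1.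
have i1 : (@lebesgue_measure R).-integrable setT (fun x => (x * normal_pdf 0 1 x)%:E).
  apply: (integrable_quadratic_growth (f := id) (C := 1)); first exact: measurable_id.
  by move=> x; rewrite mul1r norm_le_1Dsqr.
transitivity (\int[@lebesgue_measure R]_x
    (s%:E * (x * normal_pdf 0 1 x)%:E + m%:E * (normal_pdf 0 1 x)%:E))%E.
  by apply: eq_integral => x _; rewrite -!EFinM -EFinD; congr EFin; ring.
rewrite integralD//; try exact: integrableZl.
rewrite !integralZl// standard_normal_mean integral_normal_pdf.
by rewrite mule0 add0e mule1.
Qed.

Lemma integral_normal_sqr_affine (m s : R) :
  (\int[N]_z ((s * z + m) ^+ 2)%:E = (s ^+ 2 + m ^+ 2)%:E)%E.
Proof.
rewrite integral_normal_prob; last first.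
  by apply: measurable_funX; apply: measurable_funD => //; exact: measurable_funM.
have i0 := integrable_normal_pdf (0 : R) 1.
have i1 : (@lebesgue_measure R).-integrable setT (fun x => (x * normal_pdf 0 1 x)%:E).
  apply: (integrable_quadratic_growth (f := id) (C := 1)); first exact: measurable_id.
  by move=> x; rewrite mul1r norm_le_1Dsqr.
have i2 : (@lebesgue_measure R).-integrable setT (fun x => (x ^+ 2 * normal_pdf 0 1 x)%:E).
  apply: (integrable_quadratic_growth (f := fun x => x ^+ 2) (C := 1)).
    exact: measurable_funX.
  by move=> x; rewrite mul1r ger0_norm ?sqr_ge0// lerDr.
transitivity (\int[@lebesgue_measure R]_x (((s ^+ 2)%:E * (x ^+ 2 * normal_pdf 0 1 x)%:E +
   (2 * s * m)%:E * (x * normal_pdf 0 1 x)%:E) + (m ^+ 2)%:E * (normal_pdf 0 1 x)%:E))%E.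
  by apply: eq_integral => x _; rewrite -!EFinM -!EFinD; congr EFin; ring.
rewrite integralD//; [|by apply: integrableD => //; exact: integrableZl|exact: integrableZl].
rewrite integralD//; try exact: integrableZl.
rewrite !integralZl// standard_normal_mean integral_normal_pdf standard_normal_variance.
by rewrite mule0 adde0 !mule1.
Qed.

(** The first two moments identify the parameters of the law, be it a point mass or
    a normal law. *)
Lemma gaussian_charfun d (T : measurableType d) (P : probability T R) (X : T -> R) (v : R) :
  measurable_fun setT X -> gaussian_law (pushforward P X) ->
  (\int[P]_w (X w)%:E = 0)%E -> (\int[P]_w ((X w) ^+ 2)%:E = v%:E)%E ->
  (\int[P]_w cos (X w) = expR (- (v / 2)))%R.
Proof.
move=> mX gX EX EX2; rewrite /Rintegral.
have mc : measurable_fun [set: measurableTypeR R] (@cos R) by exact: measurable_cos.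
have m1 : measurable_fun [set: measurableTypeR R] (fun x : R => x) by exact: measurable_id.
have m2 : measurable_fun [set: measurableTypeR R] (fun x : R => x ^+ 2).
  exact: (measurable_funX 2 m1).
case: gX => m [Xm|[s s0 Xms]].
- have E (f : R -> R) : measurable_fun [set: measurableTypeR R] f ->
      (\int[P]_w (f (X w))%:E = (f m)%:E)%E.
    move=> mf.
    rewrite (@integral_eq_law _ _ T (measurableTypeR R) P
      (@dirac _ (measurableTypeR R) m R) X f mX Xm)//.
    rewrite integral_dirac//; last exact/measurable_EFinP.
    by rewrite diracT mul1e.
  move: EX EX2; rewrite (E _ m1) (E _ m2) (E _ mc) => -[->] [<-] /=.
  by rewrite cos0 expr0n mul0r oppr0 expR0.
- have E (f : R -> R) : measurable_fun [set: measurableTypeR R] f ->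
      (\int[P]_w (f (X w))%:E = \int[N]_z (f (s * z + m))%:E)%E.
    move=> mf; rewrite -(integral_normal_standard m s0 mf).
    exact: (@integral_eq_law _ _ T (measurableTypeR R) P (normal_prob m s) X f mX Xms).
  move: EX EX2; rewrite (E _ m1) (E _ m2) (E _ mc).
  rewrite integral_normal_affine integral_normal_sqr_affine => -[->] [<-].
  rewrite expr0n addr0.
  under eq_integral do rewrite addrC.
  by rewrite integral_normal_cos/= cos0 mul1r.
Qed.

End laws.

(** * Increments of fractional Brownian motion *)

Section fbm.
Context (R : realType) d (T : measurableType d) (P : probability T R).
Context (alpha : R) (B : R -> {RV P >-> R}).
Hypotheses (alpha_gt0 : 0 < alpha) (alpha_lt1 : alpha < 1).
Hypothesis fbmB : fractional_brownian_motion `[0, 1] alpha B.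
Local Notation N := (normal_prob (0 : R) 1).
Local Notation I01 := (`[0, 1]%classic : set R).

Lemma measurable_fbm (t : R) : measurable_fun setT (B t).
Proof. exact: measurable_funP. Qed.
Local Hint Resolve measurable_fbm : core.

(** Stationarity replaces the increment by B(t - s) - B(0), which is B(t - s) almost
    surely, and (t - s)^-alpha B(t - s) is standard normal. *)
Lemma ge0_integral_increment (s t : R) (f : R -> \bar R) : 0 <= s -> s < t -> t <= 1 ->
  measurable_fun setT f -> (forall x, 0 <= f x)%E ->
  (\int[P]_w f (B t w - B s w)%R = \int[N]_z f ((t - s) `^ alpha * z)%R)%E.
Proof.
move=> s0 st t1 mf f0.
have d0 : 0 < t - s by rewrite subr_gt0.
have d1 : t - s <= 1 by lra.
have I0 : I01 0 by rewrite /= in_itv/= lexx ler01.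
have Is : I01 s by rewrite /= in_itv/= s0 (le_trans (ltW st)).
have Id : I01 (t - s) by rewrite /= in_itv/= d1 ltW.
have Ids : I01 (t - s + s) by rewrite subrK /= in_itv/= t1 (le_trans s0)// ltW.
have st1 := @fbm_stationary _ _ _ _ _ _ _ fbmB 1 (fun=> t - s) s I0 Is (fun=> Id) (fun=> Ids).
pose X1 w : 1.-tuple R := [tuple B (t - s + s) w - B s w | i < 1].
pose X2 w : 1.-tuple R := [tuple B (t - s) w - B 0 w | i < 1].
have mB u v : measurable_fun setT (fun w => B u w - B v w) by exact: measurable_funB.
have mX1 : measurable_fun setT X1.
  apply/measurable_fun_tnthP => i; apply: eq_measurable_fun (mB (t - s + s) s) => w _.
  by rewrite /X1 /= tnth_mktuple.
have mX2 : measurable_fun setT X2.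
  apply/measurable_fun_tnthP => i; apply: eq_measurable_fun (mB (t - s) 0) => w _.
  by rewrite /X2 /= tnth_mktuple.
pose g (v : 1.-tuple R) := f (tnth v ord0).
have mg : measurable_fun setT g by apply: (measurableT_comp mf); exact: measurable_tnth.
have g0 v : (0 <= g v)%E by exact: f0.
transitivity (\int[P]_w g (X1 w))%E.
  by apply: eq_integral => w _; rewrite /g /X1 tnth_mktuple subrK.
transitivity (\int[P]_w g (X2 w))%E.
  rewrite -[LHS](ge0_integral_pushforward mX1 P measurableT mg (fun v _ => g0 v)).
  rewrite -[RHS](ge0_integral_pushforward mX2 P measurableT mg (fun v _ => g0 v)).
  by apply: eq_measure_integral => A mA _; exact: st1.
transitivity (\int[P]_w f (B (t - s) w))%E.
  apply: ge0_ae_eq_integral => //.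
  - exact: (measurableT_comp mg mX2).
  - exact: (measurableT_comp mf).
  - have := fbm0 fbmB I0; apply: filterS => w /= Bw _.
    by rewrite /g /X2 tnth_mktuple Bw subr0.
have dn := fbm_normal fbmB Id d0.
have p0 : 0 < (t - s) `^ alpha by rewrite powR_gt0.
pose g2 (x : R) := f ((t - s) `^ alpha * x).
transitivity (\int[P]_w g2 ((t - s) `^ (- alpha) * B (t - s) w)%R)%E.
  by apply: eq_integral => w _; rewrite /g2 powRN mulVKf// gt_eqF.
have mg2 : measurable_fun [set: measurableTypeR R] g2.
  by apply: (measurableT_comp mf); exact: measurable_funM.
apply: (@ge0_integral_eq_law R _ _ T (measurableTypeR R) P N _ g2 _ dn) => //.
  exact: measurable_funM.
by move=> x; exact: f0.
Qed.

Lemma integral_increment (s t : R) (f : R -> R) : 0 <= s -> s < t -> t <= 1 ->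
  measurable_fun setT f ->
  (\int[P]_w (f (B t w - B s w))%:E = \int[N]_z (f ((t - s) `^ alpha * z))%:E)%E.
Proof.
move=> s0 st t1 mf; rewrite [LHS]integralE [RHS]integralE.
have mf' : measurable_fun setT (EFin \o f) by exact/measurable_EFinP.
have Ep := ge0_integral_increment s0 st t1 (measurable_funepos mf') (funepos_ge0 _).
have En := ge0_integral_increment s0 st t1 (measurable_funeneg mf') (funeneg_ge0 _).
congr (_ - _)%E.
  transitivity (\int[P]_w ((EFin \o f)^\+ (B t w - B s w)%R))%E.
    by apply: eq_integral => w _; rewrite !funeposE.
  by rewrite Ep; apply: eq_integral => w _; rewrite !funeposE.
transitivity (\int[P]_w ((EFin \o f)^\- (B t w - B s w)%R))%E.
  by apply: eq_integral => w _; rewrite !funenegE.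
by rewrite En; apply: eq_integral => w _; rewrite !funenegE.
Qed.

Lemma integral_increment_id (s t : R) : 0 <= s -> s < t -> t <= 1 ->
  (\int[P]_w (B t w - B s w)%:E = 0)%E.
Proof.
move=> s0 st t1; rewrite (integral_increment (f := id) s0 st t1)//.
apply: etrans; last exact: (integral_normal_affine 0 ((t - s) `^ alpha)).
by apply: eq_integral => z _; rewrite addr0.
Qed.

Lemma integral_increment_sqr (s t : R) : 0 <= s <= 1 -> 0 <= t <= 1 ->
  (\int[P]_w ((B t w - B s w) ^+ 2)%:E = (`|t - s| `^ (2 * alpha))%:E)%E.
Proof.
have lt u v : 0 <= u -> u < v -> v <= 1 ->
    (\int[P]_w ((B v w - B u w) ^+ 2)%:E = (`|v - u| `^ (2 * alpha))%:E)%E.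
  move=> u0 uv v1; rewrite (integral_increment (f := fun x => x ^+ 2) u0 uv v1); last first.
    exact: measurable_funX.
  have e := integral_normal_sqr_affine 0 ((v - u) `^ alpha).
  rewrite expr0n addr0 in e; rewrite gtr0_norm ?subr_gt0// -powR_sqr -e.
  by apply: eq_integral => z _; rewrite addr0.
move=> /andP[s0 s1] /andP[t0 t1]; have [ts|st|->] := ltgtP t s.
- rewrite distrC -lt//; apply: eq_integral => w _.
  by rewrite -sqrrN opprB.
- exact: lt.
- rewrite subrr normr0 powR0; last by rewrite mulf_neq0 ?gt_eqF.
  by rewrite (eq_integral (cst 0%E)) ?integral0// => x _; rewrite subrr expr0n.
Qed.

(** The combination of increments is a combination of 2 n values of B, hence
    Gaussian; it is centred, and its variance comes from
    [integral_sqr_increments]. *)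
Lemma charfun_increments (n : nat) (t z : nat -> R) :
  (forall i, (i <= n)%N -> 0 <= t i <= 1) -> (forall i, (i < n)%N -> t i < t i.+1) ->
  (\int[P]_w cos (\sum_(i < n) z i * (B (t i.+1) w - B (t i) w)) =
    expR (- (increment_var alpha n t z / 2)))%R.
Proof.
move=> t01 tinc.
have mI i : measurable_fun setT (fun w => B (t i.+1) w - B (t i) w) by exact: measurable_funB.
apply: gaussian_charfun.
- by apply: measurable_sum => i; exact: measurable_funM.
- pose tt (j : 'I_(n + n)) := match fintype.split j with inl i => t i.+1 | inr i => t i end.
  pose cc (j : 'I_(n + n)) := match fintype.split j with inl i => z i | inr i => - z i end.
  have Itt j : I01 (tt j).
    rewrite /tt /= in_itv/=; case: (fintype.split j) => i; apply: t01 => //.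
    exact: ltnW.
  have := @fbm_gaussian _ _ _ _ _ _ _ fbmB (n + n)%N tt cc Itt.
  rewrite (_ : (fun w => _) = (fun w => \sum_(i < n) z i * (B (t i.+1) w - B (t i) w)))//.
  apply/funext => w; rewrite big_split_ord/= -big_split/=; apply: eq_bigr => i _.
  have sl : fintype.split (lshift n i) = inl i by exact: (unsplitK (inl _ i)).
  have sr : fintype.split (rshift n i) = inr i by exact: (unsplitK (inr _ i)).
  by rewrite /tt /cc sl sr; ring.
- have ii (i : 'I_n) : P.-integrable setT (EFin \o (fun w => B (t i.+1) w - B (t i) w)).
    apply: (@le_integrable _ _ _ P setT measurableT _
      (fun w => 1%:E + ((B (t i.+1) w - B (t i) w) ^+ 2)%:E)%E).
    + exact/measurable_EFinP.
    + move=> w _; rewrite lee_fin [leRHS]ger0_norm ?norm_le_1Dsqr//.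
      by rewrite addr_ge0// sqr_ge0.
    + apply: integrableD => //; first exact: finite_measure_integrable_cst.
      apply/integrableP; split.
        by apply/measurable_EFinP; exact: measurable_funX.
      under eq_integral do rewrite /= ger0_norm ?sqr_ge0//.
      by rewrite integral_increment_sqr ?ltry// t01// ltnW.
  have [A E] := Rintegral_lincomb (index_enum 'I_n) z ii.
  rewrite -[LHS]fineK; last exact: (integrable_fin_num measurableT A).
  congr EFin; rewrite [LHS]E big1// => i _.
  have /andP[ti0 _] := t01 i (ltnW (ltn_ord i)).
  have /andP[_ ti1] := t01 i.+1 (ltn_ord i).
  by rewrite /Rintegral integral_increment_id ?mulr0// tinc.
- have := @integral_sqr_increments R alpha _ _ P 1 n t z (fun i w => B (t i) w).
  rewrite mul1r => -> // i k ni nk.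
  by rewrite mul1r integral_increment_sqr// t01.
Qed.

(** By [local_nondeterminism] the characteristic function of the increments divided
    by e is dominated by that of independent normal variables of standard
    deviations proportional to (t_(i+1) - t_i)^alpha / e, which is the hypothesis of
    [gaussian_small_ball]. *)
Lemma increments_small_ball (n : nat) : exists2 K : R, 0 < K &
  forall (e : R) (t : nat -> R), 0 < e ->
  (forall i, (i <= n)%N -> 0 <= t i <= 1) -> (forall i, (i < n)%N -> t i < t i.+1) ->
  (\int[P]_w (\prod_(i < n) expR (- (((B (t i.+1) w - B (t i) w) / e) ^+ 2 / 2)))%:E <=
    (K * \prod_(i < n) (e / (t i.+1 - t i) `^ alpha))%:E)%E.
Proof.
have [c c0 lnd] := local_nondeterminism alpha_gt0 alpha_lt1 n.
have sc0 : 0 < Num.sqrt c by rewrite sqrtr_gt0.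
exists ((Num.sqrt c)^-1 ^+ n); first by rewrite exprn_gt0// invr_gt0.
move=> e t e0 t01 tinc.
pose b i := Num.sqrt c * (t i.+1 - t i) `^ alpha / e.
have b0 i : (i < n)%N -> 0 < b i.
  by move=> ni; rewrite divr_gt0// mulr_gt0// powR_gt0// subr_gt0 tinc.
apply: (le_trans (@gaussian_small_ball R _ T P n
  (fun i w => (B (t i.+1) w - B (t i) w) / e) b _ b0 _)).
- by move=> i; apply: measurable_funM => //; exact: measurable_funB.
- move=> z.
  have -> : (\int[P]_w cos (\sum_(i < n) (B (t i.+1) w - B (t i) w) / e * z i) =
     expR (- (increment_var alpha n t (fun i => z i / e) / 2)))%R.
    rewrite -charfun_increments//; apply: eq_Rintegral => w _; congr cos.
    by apply: eq_bigr => i _; ring.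
  rewrite ger0_norm ?expR_ge0// -expR_sum ler_expR sumrN lerN2.
  have := lnd t (fun i => z i / e) tinc.
  rewrite -mulr_suml ler_pM2r ?invr_gt0//; apply: le_trans.
  rewrite mulr_sumr; apply: ler_sum => i _.
  rewrite /b mulrC -powR_sqr !exprMn sqr_sqrtr ?(ltW c0)//.
  by rewrite le_eqVlt; apply/orP; left; apply/eqP; ring.
rewrite lee_fin le_eqVlt; apply/orP; left; apply/eqP.
have -> : (Num.sqrt c)^-1 ^+ n = \prod_(i < n) (Num.sqrt c)^-1.
  by rewrite prodr_const card_ord.
rewrite -big_split/=; apply: eq_bigr => i _.
by rewrite /b !invfM invrK; ring.
Qed.

End fbm.

(** * Chains of nearly equal values *)

Section chains.
Context (R : realType) (top L : nat) (e : R).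

(** A smooth substitute for the indicator of |b_l - b_k| <= e. *)
Definition gauss_link (b : nat -> R) (k l : nat) : R :=
  expR (- (((b l - b k) / e) ^+ 2 / 2)).

(** A smooth count of the chains i < k_1 < ... < k_q <= top with steps of length at
    most L along which b moves by O(e) at each step. *)
Fixpoint chain_weight (b : nat -> R) (q i : nat) : R :=
  if q is q'.+1 then
    \sum_(k < L) (i + k.+1 <= top)%N%:R *
      (gauss_link b i (i + k.+1)%N * chain_weight b q' (i + k.+1)%N)
  else 1.

Lemma gauss_link_ge0 b k l : 0 <= gauss_link b k l.
Proof. exact: expR_ge0. Qed.

Lemma chain_weight_ge0 b q i : 0 <= chain_weight b q i.
Proof.
elim: q i => [|q IH] i //=; apply: sumr_ge0 => k _.
by rewrite mulr_ge0// mulr_ge0 ?gauss_link_ge0.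
Qed.

Lemma ler_sum_subset (I : eqType) (s r : seq I) (F : I -> R) : uniq s -> {subset s <= r} ->
  (forall x, 0 <= F x) -> \sum_(x <- s) F x <= \sum_(x <- r) F x.
Proof.
move=> us sr F0; elim: s r us sr => [|x s IH] r /=.
  by move=> _ _; rewrite big_nil sumr_ge0.
move=> /andP[xs us] sr; have xr : x \in r by apply: sr; rewrite mem_head.
rewrite big_cons (perm_big _ (perm_to_rem xr)) big_cons lerD2l; apply: IH => // y ys.
have yr : y \in r by apply: sr; rewrite inE ys orbT.
have := perm_mem (perm_to_rem xr) y; rewrite yr inE => /esym/predU1P[yx|//].
by rewrite -yx ys in xs.
Qed.

(** Every choice of q points of s, in increasing order, is a chain all of whose links
    weigh at least exp(-D^2/2).  The count follows the recursion of the weight: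
    classifying by the first point chosen is Pascal's rule. *)
Lemma chain_weight_ge (b : nat -> R) (D : R) (q i : nat) (s : seq nat) :
  0 < e -> path ltn i s ->
  (forall k, k \in s -> (k <= top)%N && (k <= i + L)%N) ->
  (forall k l, k \in i :: s -> l \in i :: s -> `|b k - b l| <= D * e) ->
  expR (- (D ^+ 2 / 2)) ^+ q * 'C(size s, q)%:R <= chain_weight b q i.
Proof.
move=> e0; elim: q i s => [|q IH] i s ps sL sD; first by rewrite expr0 bin0 mul1r.
set c := expR _ in IH *; have c0 : 0 <= c by exact: expR_ge0.
have D0 : 0 <= D.
  by have := sD i i (mem_head _ _) (mem_head _ _); rewrite subrr normr0 pmulr_lge0.
have link k : k \in s -> c <= gauss_link b i k.
  move=> ks; rewrite /c /gauss_link ler_expR lerN2 ler_pM2r ?invr_gt0//.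
  rewrite -[leLHS]real_normK ?num_real// lerXn2r ?nnegrE// normrM normfV (gtr0_norm e0).
  by rewrite ler_pdivrMr// sD// ?mem_head// inE ks orbT.
have sorted_le : forall s', path ltn i s' -> {subset s' <= s} ->
    c ^+ q * 'C(size s', q.+1)%:R <= \sum_(k <- s') chain_weight b q k.
  (* s' is a tail of s, and j the point of i :: s just before it *)
  have gen j s' : (i <= j)%N -> path ltn j s' -> {subset s' <= s} ->
      c ^+ q * 'C(size s', q.+1)%:R <= \sum_(k <- s') chain_weight b q k.
    elim: s' j => [|k s' IHs] j ij /=; first by rewrite bin0n mulr0 big_nil.
    move=> /andP[jk ps'] ss; rewrite big_cons binS natrD mulrDr addrC.
    have ks : k \in s by apply: ss; rewrite mem_head.
    have ss' : {subset s' <= s} by move=> l ls; apply: ss; rewrite inE ls orbT.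
    apply: lerD; last by apply: (IHs k) => //; rewrite (leq_trans ij)// ltnW.
    apply: IH => // [l ls|l l' ls ls'].
      have /andP[-> /= h] := sL l (ss' l ls).
      by rewrite (leq_trans h)// leq_add2r (leq_trans ij)// ltnW.
    have sub x : x \in k :: s' -> x \in i :: s by move=> xs; rewrite inE ss ?orbT.
    exact: sD (sub _ ls) (sub _ ls').
  by move=> s'; exact: gen.
rewrite exprS -mulrA; apply: (@le_trans _ _ (c * \sum_(k <- s) chain_weight b q k)).
  by rewrite ler_wpM2l// sorted_le.
rewrite mulr_sumr /=.
pose F k := (k <= top)%N%:R * (gauss_link b i k * chain_weight b q k).
have F0 k : 0 <= F k by rewrite /F mulr_ge0// mulr_ge0 ?gauss_link_ge0 ?chain_weight_ge0.
apply: (@le_trans _ _ (\sum_(k <- s) F k)).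
  rewrite big_seq [leRHS]big_seq; apply: ler_sum => k ks; have /andP[kt _] := sL k ks.
  by rewrite /F kt mul1r ler_wpM2r ?chain_weight_ge0// link.
rewrite -(big_map (fun k : 'I_L => (i + k.+1)%N) xpredT F); apply: ler_sum_subset => //.
  exact: (sorted_uniq ltn_trans ltnn (path_sorted ps)).
move=> k ks; have /andP[_ kL] := sL k ks.
have ik : (i < k)%N by move: ps; rewrite (path_sortedE ltn_trans) => /andP[/allP/(_ _ ks)].
have kb : (k - i.+1 < L)%N by rewrite ltn_subLR// ?addSn -?addnS ?ltnS.
apply/mapP; exists (Ordinal kb); first exact: mem_index_enum.
by rewrite /= addnS -addSn subnKC.
Qed.

End chains.

(** * Expected weight of chains *)

Section chain_expectation.
Context (R : realType) d (T : measurableType d) (P : probability T R).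
Context (top L : nat) (e : R) (X : nat -> T -> R).
Hypothesis mX : forall k, measurable_fun setT (X k).
Local Notation traj w := (fun k => X k w).
Local Notation Z q i w := (chain_weight top L e (traj w) q i).

Lemma measurable_gauss_link k l : measurable_fun setT (fun w => gauss_link e (traj w) k l).
Proof.
apply: measurableT_comp => //; apply: measurableT_comp => //.
apply: measurable_funM => //; apply: measurable_funX; apply: measurable_funM => //.
exact: measurable_funB.
Qed.

Lemma measurable_chain_weight q i : measurable_fun setT (fun w => Z q i w).
Proof.
elim: q i => [|q IH] i /=; first exact: measurable_cst.
apply: measurable_sum => k; apply: measurable_funM => //; apply: measurable_funM => //.
exact: measurable_gauss_link.
Qed.

(** Expanding the weight one step at a time leaves the expectations of products of
    links along complete chains; the bound for these is a product over the steps,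
    so that the sum over all chains factorises. *)
Lemma expected_chain_weight_le (Q : nat) (K : R) (om : nat -> R) :
  0 <= K -> (forall k, 0 <= om k) ->
  (forall t : nat -> nat, (forall i, (i < Q)%N -> (t i < t i.+1)%N) -> (t Q <= top)%N ->
    \int[P]_w (\prod_(i < Q) gauss_link e (traj w) (t i) (t i.+1))%:E <=
      (K * \prod_(i < Q) om (t i.+1 - t i)%N)%:E)%E ->
  forall i, (i <= top)%N ->
  (\int[P]_w (Z Q i w)%:E <= (K * (\sum_(k < L) om k.+1) ^+ Q)%:E)%E.
Proof.
move=> K0 om0 hyp.
set W := \sum_(_ < _) _; have W0 : 0 <= W by exact: sumr_ge0.
(* the first j steps, along t, are fixed and q steps are left to sum over *)
have gen q j (t : nat -> nat) : (q + j)%N = Q ->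
    (forall i, (i < j)%N -> (t i < t i.+1)%N) -> (t j <= top)%N ->
    (\int[P]_w ((\prod_(i < j) gauss_link e (traj w) (t i) (t i.+1)) * Z q (t j) w)%:E <=
      (K * (\prod_(i < j) om (t i.+1 - t i)%N) * W ^+ q)%:E)%E.
  elim: q j t => [|q IH] j t.
    rewrite add0n => -> tinc tQ; rewrite expr0 mulr1.
    by under eq_integral do rewrite /= mulr1; exact: hyp.
  move=> qj tinc tj.
  pose G (k : nat) w := (t j + k.+1 <= top)%N%:R *
    ((\prod_(i < j) gauss_link e (traj w) (t i) (t i.+1)) *
     (gauss_link e (traj w) (t j) (t j + k.+1)%N * Z q (t j + k.+1)%N w)).
  have G0 k w : 0 <= G k w.
    rewrite /G mulr_ge0// mulr_ge0 ?mulr_ge0 ?gauss_link_ge0 ?chain_weight_ge0//.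
    by apply: prodr_ge0 => i _; exact: gauss_link_ge0.
  have mP (t' : nat -> nat) j' : measurable_fun setT
      (fun w => \prod_(i < j') gauss_link e (traj w) (t' i) (t' i.+1)).
    by apply: measurable_prod => i _; exact: measurable_gauss_link.
  have mG k : measurable_fun setT (G k).
    apply: measurable_funM => //; apply: measurable_funM; first exact: mP.
    apply: measurable_funM; [exact: measurable_gauss_link|exact: measurable_chain_weight].
  rewrite (eq_integral (fun w => \sum_(k < L) (G k w)%:E)%E); last first.
    move=> w _; rewrite /= mulr_sumr sumEFin; congr EFin; apply: eq_bigr => k _.
    by rewrite /G; ring.
  rewrite ge0_integral_sum//; last 2 first.
  - by move=> k; exact/measurable_EFinP.
  - by move=> k w _; rewrite lee_fin.
  set p := \prod_(_ < _) om _.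
  have -> : K * p * W ^+ q.+1 = \sum_(k < L) om k.+1 * (K * p) * W ^+ q.
    by rewrite -!mulr_suml -/W exprS; ring.
  rewrite -sumEFin; apply: lee_sum => k _.
  have rhs0 : 0 <= om k.+1 * (K * p) * W ^+ q.
    by rewrite !mulr_ge0 ?exprn_ge0 ?prodr_ge0.
  rewrite /G; have [kt|kt] := boolP (t j + k.+1 <= top)%N; last first.
    under eq_integral do rewrite mul0r.
    by rewrite integral0 lee_fin.
  (* the chain t extended by a step of length k.+1 *)
  pose t' i := if (i <= j)%N then t i else (t j + k.+1)%N.
  have t'E i : (i <= j)%N -> t' i = t i by rewrite /t' => ->.
  have t'S : t' j.+1 = (t j + k.+1)%N by rewrite /t' ltnn.
  have := IH j.+1 t'; rewrite addnS -addSn => /(_ qj).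
  rewrite t'S; move=> /(_ _ kt) h.
  apply: le_trans (le_trans (h _) _).
  - rewrite le_eqVlt; apply/orP; left; apply/eqP; apply: eq_integral => w _.
    rewrite mul1r mulrA big_ord_recr/= t'S (t'E j)//; congr (_ * _ * _)%:E.
    by apply: eq_bigr => i _; rewrite !t'E// ltnW.
  - move=> i; rewrite ltnS leq_eqVlt => /predU1P[->|ij].
      by rewrite t'S t'E// addnS ltnS leq_addr.
    by rewrite !t'E ?tinc// ltnW.
  - rewrite lee_fin big_ord_recr/= t'S (t'E j)// addKn.
    rewrite le_eqVlt; apply/orP; left; apply/eqP.
    rewrite (eq_bigr (fun i : 'I_j => om (t i.+1 - t i)%N)); first by rewrite -/p; ring.
    by move=> i _; rewrite !t'E// ltnW.
move=> i it; have := gen Q 0%N (fun=> i) (addn0 Q) (fun k (kl : (k < 0)%N) => ltac:(by [])) it.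
rewrite big_ord0 mulr1.
by under eq_integral do rewrite big_ord0 mul1r.
Qed.

End chain_expectation.

(** * Partial sums of negative powers *)

Section power_sums.
Context (R : realType) (alpha : R).
Hypotheses (alpha_gt0 : 0 < alpha) (alpha_lt1 : alpha < 1).

(** Young's inequality: the concave power lies below its tangent at 1. *)
Lemma powR_le_tangent (y r : R) : 0 <= y -> 0 < r -> r < 1 -> y `^ r <= r * y + (1 - r).
Proof.
move=> y0 r0 r1; have r1' : 0 < 1 - r by rewrite subr_gt0.
have := @conjugate_powR R (y `^ r) 1 r^-1 (1 - r)^-1 (powR_ge0 _ _) ler01.
rewrite !invr_gt0 r0 r1' !invrK => /(_ isT isT).
rewrite mulr1 powR1 mul1r -powRrM mulfV ?gt_eqF// powRr1// mulrC [r * y]mulrC.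
by rewrite mulrC; apply; lra.
Qed.

(** By induction, as in the comparison of the sum with the integral of x^-alpha:
    concavity of x^(1 - alpha) bounds L.+1^-alpha by the increment of the right-hand
    side. *)
Lemma sum_powRN_le (L : nat) :
  \sum_(k < L) k.+1%:R `^ (- alpha) <= (1 - alpha)^-1 * L%:R `^ (1 - alpha) :> R.
Proof.
have [a0 a1] : 0 < alpha /\ alpha < 1 by [].
have r0 : 0 < 1 - alpha by rewrite subr_gt0.
elim: L => [|L IH]; first by rewrite big_ord0 mulr_ge0 ?invr_ge0 ?powR_ge0 ?ltW.
rewrite big_ord_recr/=; apply: (le_trans (lerD IH (lexx _))).
rewrite -lerBrDl -mulrBr ler_pdivlMl//.
have L0 : (0 : R) < L.+1%:R by rewrite ltr0n.
have -> : (L%:R : R) = L.+1%:R * (L%:R / L.+1%:R) by rewrite mulrC divfK ?gt_eqF.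
rewrite powRM ?divr_ge0 ?ler0n//.
have := @powR_le_tangent (L%:R / L.+1%:R) (1 - alpha) _ r0 _.
rewrite divr_ge0 ?ler0n// => /(_ isT); rewrite (_ : 1 - alpha < 1) ?gtrBl// => /(_ isT) h.
have -> : L.+1%:R `^ (- alpha) = L.+1%:R `^ (1 - alpha) / L.+1%:R :> R.
  rewrite -[X in _ / X]powRr1 ?ler0n// -powRN -powRD ?(gt_eqF L0) ?implybT//.
  by congr (_ `^ _); ring.
rewrite mulrCA -[X in _ <= X - _]mulr1 -mulrBr ler_wpM2l ?powR_ge0//.
have : (L%:R / L.+1%:R : R) = 1 - L.+1%:R^-1.
  by rewrite -[in LHS](addrK 1 L%:R) -natr1 mulrBl divff ?gt_eqF// div1r natr1.
move=> e; rewrite e in h *; move: h; set x := L.+1%:R^-1; set y := _ `^ _ => h; nra.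
Qed.

End power_sums.

(** * Almost sure bounds from expectations *)

Section almost_sure_bounds.
Context (R : realType) d (T : measurableType d) (P : probability T R).

(** The sum of the X_n has finite expectation, hence is almost surely finite, and it
    dominates each term. *)
Lemma ae_bounded_of_geometric (X : nat -> T -> R) (C a : R) :
  (forall n, measurable_fun setT (X n)) -> (forall n w, 0 <= X n w) ->
  0 <= a < 1 -> (forall n, \int[P]_w (X n w)%:E <= (C * a ^+ n)%:E)%E ->
  {ae P, forall w, exists D, forall n, X n w <= D}.
Proof.
move=> mX X0 /andP[a0 a1] XC.
pose S w := (\sum_(n <oo) (X n w)%:E)%E.
have mXE n : measurable_fun setT (EFin \o X n) by exact/measurable_EFinP.
have S0 w : (0 <= S w)%E by apply: nneseries_ge0 => n _ _; rewrite lee_fin.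
have mS : measurable_fun setT S.
  have X0E (n : nat) w : setT w -> true -> (0 <= (X n w)%:E)%E by rewrite lee_fin.
  exact: (@ge0_emeasurable_sum _ _ _ setT (fun n w => (X n w)%:E) xpredT X0E
    (fun n _ => mXE n)).
have Slty : (\int[P]_w S w < +oo)%E.
  rewrite integral_nneseries//; last by move=> n w _; rewrite lee_fin.
  apply: (@le_lt_trans _ _ (\sum_(n <oo) (C * a ^+ n)%:E)%E).
    apply: lee_nneseries => n _; last exact: XC.
    by move=> _; apply: integral_ge0 => w _; rewrite lee_fin.
  have := @cvg_geometric_series R C a; rewrite ger0_norm// => /(_ a1) cg.
  have -> : (\sum_(n <oo) (C * a ^+ n)%:E = (C * (1 - a)^-1)%:E)%E; last by rewrite ltry.
  apply/cvg_lim => //.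
  rewrite (_ : (fun n => _) = (fun n => (series (geometric C a) n)%:E)).
    by apply: cvg_EFin; [exact: nearW|exact: cg].
  by apply/funext => n; rewrite /series/= sumEFin.
have iS : P.-integrable setT S.
  apply/integrableP; split => //.
  by under eq_integral do rewrite gee0_abs//.
have := integrable_ae measurableT iS; apply: filterS => w /(_ I) fS.
exists (fine (S w)) => n; rewrite -lee_fin fineK//.
have := @nneseries_lim_ge R (fun n => (X n w)%:E) xpredT 0 n.+1.
move=> /(_ (fun n _ => _)) h; apply: le_trans (h _) => [|k _]; last by rewrite lee_fin.
by rewrite big_nat_recr//= leeDr// sume_ge0// => k _; rewrite lee_fin.
Qed.

End almost_sure_bounds.

(** * Fractional Brownian motion on the grid *)

Section fbm_bounds.
Context (R : realType) d (T : measurableType d) (P : probability T R).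
Context (alpha : R) (B : R -> {RV P >-> R}) (M : nat).
Hypotheses (alpha_gt0 : 0 < alpha) (alpha_lt1 : alpha < 1).
Hypothesis fbmB : fractional_brownian_motion `[0, 1] alpha B.
Hypothesis M_ge2 : (2 <= M)%N.
Local Notation r := (M%:R : R).

Definition grid_point (n k : nat) : R := k%:R / M%:R ^+ n.
Local Notation grid := grid_point.

Let r_gt1 : 1 < r. Proof. by rewrite ltr1n. Qed.
Let r_gt0 : 0 < r. Proof. by rewrite ltr0n (leq_trans _ M_ge2). Qed.
Let rn_gt0 n : 0 < r ^+ n. Proof. by rewrite exprn_gt0. Qed.
Let rV01 : 0 <= r^-1 < 1. Proof. by rewrite invr_ge0 ltW// invf_lt1. Qed.

Let rnV_powR n (a : R) : (r ^+ n)^-1 `^ a = r `^ (- (n%:R * a)).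
Proof. by rewrite -powR_mulrn ?(ltW r_gt0)// -powRN -powRrM mulNr. Qed.

Lemma grid01 n k : (k <= M ^ n)%N -> 0 <= grid n k <= 1.
Proof.
move=> kM; rewrite /grid_point divr_ge0 ?ler0n ?(ltW (rn_gt0 n))//=.
by rewrite ler_pdivrMr// mul1r -natrX ler_nat.
Qed.

Lemma gridB n k l : (k <= l)%N -> grid n l - grid n k = (l - k)%N%:R / r ^+ n.
Proof. by move=> kl; rewrite /grid_point -mulrBl natrB. Qed.

(** The normalised increment over a cell is standard normal, so the exponential has
    expectation sqrt 2; the sum over the M^n cells, divided by M^(2 n), has geometric
    expectations. *)
Lemma ae_grid_increments_exp : {ae P, forall w, exists D, forall n p, (p < M ^ n)%N ->
  expR ((r `^ (n%:R * alpha) * (B (grid n p.+1) w - B (grid n p) w)) ^+ 2 / 4) <=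
    D * r ^+ (2 * n)}.
Proof.
pose h n p w := expR ((r `^ (n%:R * alpha) * (B (grid n p.+1) w - B (grid n p) w)) ^+ 2 / 4).
have h0 n p w : 0 <= h n p w by exact: expR_ge0.
have mh n p : measurable_fun setT (h n p).
  apply: measurableT_comp => //; apply: measurable_funM => //; apply: measurable_funX.
  apply: measurable_funM => //; apply: measurable_funB; exact: measurable_funP.
pose X n w := (r ^+ (2 * n))^-1 * \sum_(p < M ^ n) h n p w.
have X0 n w : 0 <= X n w by rewrite mulr_ge0 ?invr_ge0 ?exprn_ge0 ?(ltW r_gt0)// sumr_ge0.
have mX n : measurable_fun setT (X n).
  by apply: measurable_funM => //; apply: measurable_sum.
have Ih n p : (p < M ^ n)%N -> (\int[P]_w (h n p w)%:E = (Num.sqrt 2)%:E)%E.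
  move=> pM.
  have /andP[g0 _] := grid01 (ltnW pM); have /andP[_ g1] := grid01 pM.
  have gB : grid n p.+1 - grid n p = (r ^+ n)^-1 by rewrite gridB// subSnn div1r.
  have gl : grid n p < grid n p.+1 by rewrite -subr_gt0 gB invr_gt0.
  pose f (x : R) := (expR ((r `^ (n%:R * alpha) * x) ^+ 2 / 4))%:E.
  rewrite (ge0_integral_increment (f := f) fbmB g0 gl g1); last 2 first.
  - apply/measurable_EFinP; apply: measurableT_comp => //; apply: measurable_funM => //.
    by apply: measurable_funX; exact: measurable_funM.
  - by move=> x; rewrite lee_fin expR_ge0.
  have s20 : 0 < Num.sqrt 2 :> R by rewrite sqrtr_gt0.
  rewrite -(gauss_weight s20); apply: eq_integral => z _; rewrite /f.
  rewrite mulrA gB rnV_powR -powRD ?(gt_eqF r_gt0) ?implybT//.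
  by rewrite subrr powRr0 mul1r sqr_sqrtr//; congr (expR _)%:E; field.
have := @ae_bounded_of_geometric R _ T P X (Num.sqrt 2) r^-1 mX X0 rV01.
have XC n : (\int[P]_w (X n w)%:E <= (Num.sqrt 2 * r^-1 ^+ n)%:E)%E.
  rewrite /X; under eq_integral do rewrite EFinM -sumEFin.
  rewrite ge0_integralZl_EFin ?invr_ge0 ?exprn_ge0 ?(ltW r_gt0)//; last 2 first.
  - by move=> w _; apply: sume_ge0 => p _; rewrite lee_fin.
  - by apply: emeasurable_sum => p; exact/measurable_EFinP.
  rewrite ge0_integral_sum//; last 2 first.
  - by move=> p; exact/measurable_EFinP.
  - by move=> p w _; rewrite lee_fin.
  rewrite (eq_bigr (fun=> (Num.sqrt 2)%:E)); last by move=> p _; rewrite Ih.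
  rewrite sumEFin -EFinM lee_fin sumr_const card_ord.
  rewrite -[_ *+ (M ^ n)]mulr_natr natrX.
  rewrite mul2n -addnn exprD invfM exprVn.
  by rewrite le_eqVlt; apply/orP; left; apply/eqP; field; rewrite gt_eqF.
move=> /(_ XC); apply: filterS => w [D hD]; exists D => n p pM.
have := hD n; rewrite /X ler_pdivrMl ?exprn_gt0// [_ * D]mulrC; apply: le_trans.
rewrite -/(h n p w) (bigD1 (Ordinal pM))//= lerDl sumr_ge0//.
Qed.

(** At level n there are at most (n + 1) M^n <= M^(2 n) pairs of a window l and a
    starting point i.  After division by its expected order, the sum of the chain
    weights over these pairs, divided by M^(3 n), has geometric expectations. *)
Lemma ae_chain_weights (Q : nat) (delta : R) : {ae P, forall w, exists D, forall n l i,
  (l <= n)%N -> (i < M ^ n)%N ->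
  chain_weight (M ^ n) (M ^ l) (r `^ (- (n%:R * (alpha - delta)))) (fun k => B (grid n k) w) Q i
   <= D * r ^+ (3 * n) * (r `^ (n%:R * delta) * r `^ (l%:R * (1 - alpha))) ^+ Q}.
Proof.
have [K K0 sb] := increments_small_ball alpha_gt0 alpha_lt1 fbmB Q.
pose e n := r `^ (- (n%:R * (alpha - delta))).
have e0 n : 0 < e n by rewrite powR_gt0.
pose Z n l i w := chain_weight (M ^ n) (M ^ l) (e n) (fun k => B (grid n k) w) Q i.
pose bd n l := (r `^ (n%:R * delta) * r `^ (l%:R * (1 - alpha))) ^+ Q.
have bd0 n l : 0 < bd n l by rewrite exprn_gt0// mulr_gt0 ?powR_gt0.
have Z0 n l i w : 0 <= Z n l i w by exact: chain_weight_ge0.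
have mB t : measurable_fun setT (B t) by exact: measurable_funP.
have mZ n l i : measurable_fun setT (Z n l i).
  by apply: (@measurable_chain_weight R _ T (M ^ n) (M ^ l) (e n) (fun k => B (grid n k))).
pose C := K * ((1 - alpha)^-1) ^+ Q.
have C0 : 0 <= C by rewrite mulr_ge0 ?ltW// exprn_gt0// invr_gt0 subr_gt0.
have IZ n l i : (i < M ^ n)%N -> (\int[P]_w (Z n l i w)%:E <= (C * bd n l)%:E)%E.
  move=> iM.
  pose om k := r `^ (n%:R * delta) * k%:R `^ (- alpha).
  have om0 k : 0 <= om k by rewrite mulr_ge0 ?powR_ge0.
  have := @expected_chain_weight_le R _ T P (M ^ n) (M ^ l) (e n) (fun k => B (grid n k))
     (fun k => mB _) Q K om (ltW K0) om0.
  move=> /(_ _ i (ltnW iM)) h; apply: (le_trans (h _)) => [t tinc tQ|].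
    (* the chain stays below its last point *)
    have tle j : (j <= Q)%N -> (t j <= M ^ n)%N.
      move=> jQ; apply: leq_trans tQ; move: jQ.
      elim: Q tinc {h sb C C0 Z bd bd0 Z0 mZ} => [|q IHq] tinc.
        by rewrite leqn0 => /eqP ->.
      rewrite leq_eqVlt => /predU1P[-> //|]; rewrite ltnS => jq.
      rewrite (leq_trans (IHq _ jq))// => [k kq|]; first by apply: tinc; exact: ltnW.
      by apply: ltnW; exact: tinc.
    apply: le_trans (sb (e n) (fun j => grid n (t j)) (e0 n) _ _) _.
    - by move=> j jQ; exact/grid01/tle.
    - move=> j jQ; rewrite -subr_gt0 gridB ?(ltnW (tinc j jQ))//.
      by rewrite divr_gt0// ltr0n subn_gt0 tinc.
    rewrite lee_fin ler_pM2l//; apply: ler_prod => j _.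
    rewrite divr_ge0 ?powR_ge0 ?(ltW (e0 n))//=.
    have tj := tinc j (ltn_ord j).
    rewrite gridB ?(ltnW tj)// /om powRM ?ler0n ?invr_ge0 ?(ltW (rn_gt0 n))//.
    rewrite rnV_powR [_ `^ (- alpha)]powRN invfM -[(r `^ (- _))^-1]powRN opprK mulrA mulrAC /e.
    rewrite -powRD ?(gt_eqF r_gt0) ?implybT// le_eqVlt; apply/orP; left; apply/eqP.
    by congr (_ `^ _ * _); ring.
  rewrite lee_fin /C -mulrA ler_pM2l// -exprMn lerXn2r ?nnegrE//.
  - by apply: sumr_ge0.
  - by rewrite !mulr_ge0 ?powR_ge0 ?invr_ge0 ?subr_ge0 ?(ltW alpha_lt1).
  rewrite /om -mulr_sumr mulrCA ler_pM2l ?powR_gt0//.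
  apply: (le_trans (sum_powRN_le _ _ _)) => //.
  by rewrite natrX -powR_mulrn ?(ltW r_gt0)// -powRrM.
pose X n w := (r ^+ (3 * n))^-1 * \sum_(l < n.+1) \sum_(i < M ^ n) Z n l i w / bd n l.
have X0 n w : 0 <= X n w.
  rewrite mulr_ge0 ?invr_ge0 ?exprn_ge0 ?(ltW r_gt0)//.
  by apply: sumr_ge0 => l _; apply: sumr_ge0 => i _; rewrite divr_ge0// (ltW (bd0 _ _)).
have mX n : measurable_fun setT (X n).
  apply: measurable_funM => //; apply: measurable_sum => l; apply: measurable_sum => i.
  exact: measurable_funM.
have XC n : (\int[P]_w (X n w)%:E <= (C * r^-1 ^+ n)%:E)%E.
  have mZE l i : measurable_fun setT (fun w => (Z n l i w / bd n l)%:E).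
    by apply/measurable_EFinP; exact: measurable_funM.
  have ZE0 l i w : (0 <= (Z n l i w / bd n l)%:E)%E.
    by rewrite lee_fin divr_ge0// (ltW (bd0 _ _)).
  rewrite /X (eq_integral (fun w => (r ^+ (3 * n))^-1%:E *
    \sum_(l < n.+1) \sum_(i < M ^ n) (Z n l i w / bd n l)%:E)%E); last first.
    move=> w _; rewrite EFinM -sumEFin; congr (_ * _)%E.
    by apply: eq_bigr => l _; rewrite sumEFin.
  rewrite ge0_integralZl_EFin ?invr_ge0 ?exprn_ge0 ?(ltW r_gt0)//; last 2 first.
  - by move=> w _; apply: sume_ge0 => l _; apply: sume_ge0 => i _.
  - by apply: emeasurable_sum => l; apply: emeasurable_sum => i.
  rewrite ge0_integral_sum//; last 2 first.
  - by move=> l; apply: emeasurable_sum => i.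
  - by move=> l w _; apply: sume_ge0 => i _.
  apply: (@le_trans _ _ ((r ^+ (3 * n))^-1%:E * \sum_(l < n.+1) \sum_(i < M ^ n) C%:E)%E).
    rewrite lee_wpmul2l ?lee_fin ?invr_ge0 ?exprn_ge0 ?(ltW r_gt0)//.
    apply: lee_sum => l _; rewrite ge0_integral_sum//.
    apply: lee_sum => i _.
    under eq_integral do rewrite mulrC EFinM.
    rewrite ge0_integralZl_EFin ?invr_ge0 ?(ltW (bd0 _ _))//; last 2 first.
    - by move=> w _; rewrite lee_fin.
    - exact/measurable_EFinP.
    rewrite lee_pdivrMl//.
    by rewrite -EFinM mulrC IZ.
  under eq_bigr do rewrite sumEFin.
  rewrite sumEFin -EFinM lee_fin !sumr_const !card_ord.
  rewrite -[_ *+ (M ^ n)]mulr_natr -[_ *+ n.+1]mulr_natr natrX.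
  rewrite ler_pdivrMl ?exprn_gt0//.
  have -> : r ^+ (3 * n) * (C * r^-1 ^+ n) = C * r ^+ n * r ^+ n.
    rewrite (_ : 3 * n = n + n + n)%N; last by lia.
    by rewrite !exprD exprVn; field; rewrite gt_eqF.
  apply: ler_wpM2l; first by apply: mulr_ge0 => //; exact: ltW.
  by rewrite -natrX ler_nat ltn_expl.
have := @ae_bounded_of_geometric R _ T P X C r^-1 mX X0 rV01 XC.
apply: filterS => w [D hD]; exists D => n l i le_ln iM.
have := hD n; rewrite /X ler_pdivrMl ?exprn_gt0// => h.
rewrite -/(bd n l) -ler_pdivrMr// -/(Z n l i w) [D * _]mulrC; apply: le_trans h.
have lN : (l < n.+1)%N by rewrite ltnS.
rewrite (bigD1 (Ordinal lN))//= (bigD1 (Ordinal iM))//= -addrA lerDl.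
by apply: addr_ge0; apply: sumr_ge0 => k _; rewrite ?divr_ge0 ?(ltW (bd0 _ _))//;
  apply: sumr_ge0 => k' _; rewrite ?divr_ge0 ?(ltW (bd0 _ _)).
Qed.

End fbm_bounds.

(** * Oscillation of a path inside cells *)

Section path_oscillation.
Context (R : realType) (alpha : R) (b : R -> R) (M : nat).
Hypotheses (alpha_gt0 : 0 < alpha) (alpha_lt1 : alpha < 1).
Hypothesis M_ge2 : (2 <= M)%N.
Local Notation r := (M%:R : R).
Local Notation grid := (@grid_point R M).

Let r_gt1 : 1 < r. Proof. by rewrite ltr1n. Qed.
Let r_gt0 : 0 < r. Proof. by rewrite ltr0n (leq_trans _ M_ge2). Qed.
Let rn_gt0 n : 0 < r ^+ n. Proof. by rewrite exprn_gt0. Qed.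

(** Taking logarithms, the square of the normalised increment is O(n), which is
    absorbed by M^(2 n delta). *)
Lemma grid_increments_le (delta D : R) : 0 < delta ->
  (forall n p, (p < M ^ n)%N ->
    expR ((r `^ (n%:R * alpha) * (b (grid n p.+1) - b (grid n p))) ^+ 2 / 4) <=
      D * r ^+ (2 * n)) ->
  exists2 C, 0 < C & forall n p, (p < M ^ n)%N ->
    `|b (grid n p.+1) - b (grid n p)| <= C * r `^ (- (n%:R * (alpha - delta))).
Proof.
move=> d0 hD.
have D0 : 0 < D.
  have := hD 0%N 0%N; rewrite expn0 muln0 expr0 mulr1 => /(_ isT).
  exact: lt_le_trans (expR_gt0 _).
(* chosen so that E (1 + q)^2 >= ln D + 2 q / delta for q = n delta ln r >= 0 *)
pose E := `|ln D| + delta^-1 + 1.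
have E1 : 1 <= E by rewrite /E lerDr addr_ge0// invr_ge0 ltW.
have E0 : 0 < E by exact: lt_le_trans E1.
have lnr0 : 0 < ln r by rewrite ln_gt0.
exists (2 * E); first by rewrite mulr_gt0.
move=> n p pM; set x := b _ - b _.
have pa : 0 < r `^ (n%:R * alpha) by rewrite powR_gt0.
have pd : 0 < r `^ (n%:R * delta) by rewrite powR_gt0.
rewrite (_ : - _ = n%:R * delta - n%:R * alpha); last by ring.
rewrite powRB ?(gt_eqF r_gt0) ?implybT// mulrA ler_pdivlMr//.
set y := r `^ (n%:R * alpha) * x.
have -> : `|x| * r `^ (n%:R * alpha) = `|y| by rewrite normrM (gtr0_norm pa) mulrC.
have h : y ^+ 2 / 4 <= ln D + 2 * n%:R * ln r.
  have := hD n p pM; rewrite -/x -/y -ler_ln ?posrE ?expR_gt0 ?mulr_gt0//.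
  by rewrite expRK lnM ?posrE// lnXn// -[_ *+ (2 * n)]mulr_natl natrM.
have h2 : 1 + n%:R * delta * ln r <= r `^ (n%:R * delta).
  by rewrite /powR gt_eqF// expR_ge1Dx.
have h3 : y ^+ 2 / 4 <= (E * r `^ (n%:R * delta)) ^+ 2.
  apply: (le_trans h).
  have q0 : 0 <= n%:R * delta * ln r by rewrite !mulr_ge0// ltW.
  have h4 : ln D + 2 * n%:R * ln r <= E * (1 + n%:R * delta * ln r) ^+ 2.
    have l1 : ln D <= `|ln D| by exact: ler_norm.
    have l0 : 0 <= `|ln D| by [].
    have di : delta^-1 * delta = 1 by rewrite mulVf ?gt_eqF.
    have e2 : 2 * n%:R * ln r = delta^-1 * (2 * (n%:R * delta * ln r)).
      by rewrite -[LHS]mul1r -di; ring.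
    rewrite e2; set q := n%:R * delta * ln r in q0 *.
    have dq : 0 <= delta^-1 * q ^+ 2 by rewrite mulr_ge0 ?sqr_ge0 ?invr_ge0 ?(ltW d0).
    have di0 : 0 < delta^-1 by rewrite invr_gt0.
    rewrite /E; nra.
  apply: (le_trans h4); rewrite exprMn.
  apply: ler_pM; rewrite ?sqr_ge0 ?(ltW E0)//.
    by rewrite expr2 ler_peMl// ltW.
  by rewrite lerXn2r ?nnegrE ?powR_ge0// addr_ge0.
have h5 : `|y| ^+ 2 <= (2 * E * r `^ (n%:R * delta)) ^+ 2.
  rewrite real_normK ?num_real// -[2 * E * _]mulrA [leRHS]exprMn.
  by move: h3; set u := (E * _) ^+ 2; lra.
by rewrite -(@ler_pXn2r _ 2) ?nnegrE// !mulr_ge0 ?powR_ge0 ?(ltW E0).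
Qed.

Lemma gridSn n p : grid n.+1 (M * p)%N = grid n p.
Proof. by rewrite /grid_point natrM exprS invfM mulrACA divff ?gt_eqF// mul1r. Qed.

Definition cell_index (n : nat) (x : R) : nat := Num.truncn (x * r ^+ n).
Local Notation cell := cell_index.

Lemma cell_lt n x : 0 <= x < 1 -> (cell n x < M ^ n)%N.
Proof.
move=> /andP[x0 x1]; rewrite /cell_index -(ltr_nat R) natrX.
apply: (@le_lt_trans _ _ (x * r ^+ n)); last by rewrite gtr_pMl.
by rewrite truncn_le// mulr_ge0// ltW.
Qed.

Lemma cell_bounds n x : 0 <= x -> grid n (cell n x) <= x < grid n (cell n x).+1.
Proof.
move=> x0; have xr : 0 <= x * r ^+ n by rewrite mulr_ge0// ltW.
have /andP[h1 h2] := truncn_itv xr.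
by rewrite /grid_point ler_pdivrMr// ltr_pdivlMr// h1 h2.
Qed.

Lemma cellS n x : 0 <= x -> exists2 j, (j < M)%N & cell n.+1 x = (M * cell n x + j)%N.
Proof.
move=> x0; have /andP[a1 a2] := cell_bounds n x0; have /andP[c1 c2] := cell_bounds n.+1 x0.
have M0 : (0 < M)%N by exact: leq_trans M_ge2.
have l1 : (M * cell n x < (cell n.+1 x).+1)%N.
  rewrite -(ltr_nat R) -(ltr_pM2r (_ : 0 < (r ^+ n.+1)^-1)) ?invr_gt0//.
  by rewrite -/(grid _ _) -/(grid _ _) gridSn (le_lt_trans a1 c2).
have l2 : (cell n.+1 x < M * (cell n x).+1)%N.
  rewrite -(ltr_nat R) -(ltr_pM2r (_ : 0 < (r ^+ n.+1)^-1)) ?invr_gt0//.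
  by rewrite -/(grid _ _) -/(grid _ _) gridSn (le_lt_trans c1 a2).
exists (cell n.+1 x - M * cell n x)%N; last by rewrite subnKC.
by rewrite ltn_subLR// addnC -mulnS.
Qed.

Hypothesis cb : {within `[0, 1], continuous b}.

(** From level m to level m + 1 the left end point of the cell of x moves across
    fewer than M cells, so b changes by O(M^-(m gamma)) there; summing over m >= n
    and letting m tend to infinity, continuity reaches x itself. *)
Lemma cell_oscillation (gamma C : R) : 0 < gamma ->
  (forall n p, (p < M ^ n)%N ->
    `|b (grid n p.+1) - b (grid n p)| <= C * r `^ (- (n%:R * gamma))) ->
  exists2 D, 0 < D & forall n x, 0 <= x < 1 ->
    `|b x - b (grid n (cell n x))| <= D * r `^ (- (n%:R * gamma)).
Proof.
move=> g0 hC.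
have C0 : 0 <= C.
  by have := hC 0%N 0%N isT; rewrite mul0r oppr0 powRr0 mulr1; exact: le_trans.
pose a := r `^ (- gamma).
have a0 : 0 < a by rewrite powR_gt0.
have a1 : a < 1.
  rewrite /a powRN invf_lt1 ?powR_gt0// -[X in X < _](powRr0 r).
  by rewrite /powR gt_eqF// ltr_expR ltr_pM2r ?ln_gt0.
have aE n : r `^ (- (n%:R * gamma)) = a ^+ n.
  by rewrite -powR_mulrn ?(ltW a0)// /a -powRrM; congr (_ `^ _); ring.
have step n x : 0 <= x < 1 ->
    `|b (grid n.+1 (cell n.+1 x)) - b (grid n (cell n x))| <= r * C * a ^+ n.
  move=> x01; have /andP[x0 _] := x01; have [j jM cE] := cellS n x0.
  have cl := cell_lt n.+1 x01.
  have : forall k, (k <= j)%N ->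
      `|b (grid n.+1 (M * cell n x + k)%N) - b (grid n (cell n x))| <= k%:R * (C * a ^+ n).
    elim=> [_|k IH kj]; first by rewrite addn0 gridSn subrr normr0 mul0r.
    have kM : (M * cell n x + k < M ^ n.+1)%N.
      by apply: leq_ltn_trans cl; rewrite cE leq_add2l ltnW.
    have := hC n.+1 _ kM; rewrite aE exprS -addnS => h.
    have h1 : C * (a * a ^+ n) <= C * a ^+ n.
      by rewrite ler_wpM2l// ler_piMl ?exprn_ge0 ?(ltW a0)// ltW.
    rewrite -(subrK (b (grid n.+1 (M * cell n x + k)%N)) (b _)) -addrA.
    rewrite (le_trans (ler_normD _ _))// -natr1 mulrDl mul1r [leRHS]addrC lerD ?IH 1?ltnW//.
    exact: le_trans h h1.
  move=> /(_ j (leqnn _)); rewrite -cE => h; apply: (le_trans h).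
  rewrite -mulrA ler_wpM2r ?mulr_ge0 ?exprn_ge0 ?(ltW a0)// ler_nat ltnW//.
pose D := r * C / (1 - a) + 1.
have D0 : 0 < D by rewrite ltr_wpDl// divr_ge0 ?subr_ge0 ?(ltW a1)// mulr_ge0// ltW.
exists D => // n x x01; have /andP[x0 x1] := x01.
(* the partial sums of the geometric series of ratio a, in closed form *)
have tele m : `|b (grid (n + m)%N (cell (n + m)%N x)) - b (grid n (cell n x))| <=
    r * C / (1 - a) * (1 - a ^+ m) * a ^+ n.
  elim: m => [|m IH]; first by rewrite addn0 expr0 !subrr normr0 mulr0 mul0r.
  rewrite addnS -(subrK (b (grid (n + m)%N (cell (n + m)%N x))) (b _)) -addrA.
  rewrite (le_trans (ler_normD _ _))// (le_trans (lerD (step _ _ x01) IH))//.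
  by rewrite exprD exprS le_eqVlt; apply/orP; left; apply/eqP; field; rewrite subr_eq0 gt_eqF.
have tele' m : `|b (grid (n + m)%N (cell (n + m)%N x)) - b (grid n (cell n x))| <=
    r * C / (1 - a) * a ^+ n.
  apply: (le_trans (tele m)); rewrite ler_wpM2r ?exprn_ge0 ?(ltW a0)// ler_piMr//.
    by rewrite divr_ge0 ?subr_ge0 ?(ltW a1)// mulr_ge0// ltW.
  by rewrite gerBl exprn_ge0// ltW.
rewrite aE; apply: (@le_trans _ _ (r * C / (1 - a) * a ^+ n)); last first.
  by rewrite ler_wpM2r ?exprn_ge0 ?(ltW a0)// /D lerDl.
apply/ler_addgt0Pr => e e0.
have I01x : `[0, 1]%classic x by rewrite /= in_itv/= x0 ltW.
have cbx : b @ within `[0, 1] (nbhs x) --> b x by move/subspace_continuousP : cb; exact.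
have : \forall m \near \oo, `|b x - b (grid m (cell m x))| <= e.
  have xm : grid m (cell m x) @[m --> \oo] --> within `[0, 1] (nbhs x).
    have gx : grid m (cell m x) @[m --> \oo] --> x.
      apply/cvgrPdist_le => u u0.
      have rV1 : `|r^-1| < 1 by rewrite gtr0_norm ?invr_gt0// invf_lt1.
      have := @cvg_expr R r^-1 rV1 => /cvgrPdist_le /(_ u u0); apply: filterS => m.
      rewrite sub0r normrN ger0_norm ?exprn_ge0 ?invr_ge0 ?(ltW r_gt0)//; apply: le_trans.
      have /andP[c1 c2] := cell_bounds m x0.
      rewrite ger0_norm ?subr_ge0// exprVn lerBlDr ltW// (lt_le_trans c2)//.
      by rewrite /grid_point -natr1 mulrDl mul1r addrC.
    move=> U wU; have := gx _ wU; rewrite /nbhs/=; apply: filterS => m; apply.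
    by rewrite /= in_itv/= grid01// ltnW// cell_lt.
  have := cvg_comp _ _ xm cbx.
  by move/cvgrPdist_le => /(_ _ e0).
move=> [m _ /(_ (n + m)%N (leq_addl _ _)) h].
rewrite -(subrK (b (grid (n + m)%N (cell (n + m)%N x))) (b x)) -addrA.
by rewrite (le_trans (ler_normD _ _))// [leRHS]addrC lerD.
Qed.

End path_oscillation.

(** * Counting tools *)

Section counting_tools.
Context (R : realType).

Lemma expn_subn_le_bin (m q : nat) : ((m - q) ^ q <= q`! * 'C(m, q))%N.
Proof.
rewrite mulnC bin_ffact; elim: q => [|q IH] //.
rewrite expnSr ffactnSr; apply: leq_mul; last exact: leq_sub2l.
by apply: leq_trans IH; case: q => // q; rewrite leq_exp2r// leq_sub2l.
Qed.

(** The binomial of s and Q grows like s^Q / Q!, so a bound by a Q-th power gives a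
    bound of s by the base.  The additive Q.+1 covers the truncated difference
    s - Q. *)
Lemma linear_bound_of_binomial (Q : nat) (c D2 X W : R) (s : nat) :
  (0 < Q)%N -> 0 < c -> 1 <= X ->
  W <= D2 * X ^+ Q -> c * 'C(s, Q)%:R <= W ->
  s.+1%:R <= (Num.max 1 (Q`!%:R * D2 / c) + Q.+1%:R) * X.
Proof.
move=> Q0 c0 X1 WX cW; set C1 := Num.max _ _.
have X0 : 0 <= X by exact: le_trans X1.
have C1ge1 : 1 <= C1 by rewrite /C1 le_max lexx.
have C10 : 0 <= C1 by exact: le_trans C1ge1.
have h1 : ((s - Q)%N%:R : R) ^+ Q <= (C1 * X) ^+ Q.
  apply: (@le_trans _ _ (Q`!%:R * 'C(s, Q)%:R)).
    by rewrite -natrX -natrM ler_nat expn_subn_le_bin.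
  apply: (@le_trans _ _ (Q`!%:R * (D2 * X ^+ Q / c))).
    by rewrite ler_wpM2l// ler_pdivlMr// mulrC (le_trans cW).
  rewrite exprMn !mulrA mulrAC ler_wpM2r ?exprn_ge0//.
  apply: (@le_trans _ _ C1); first by rewrite /C1 le_max lexx orbT.
  by rewrite -[leLHS]expr1 ler_weXn2l.
have h2 : ((s - Q)%N%:R : R) <= C1 * X.
  by move: h1; rewrite ler_pXn2r// nnegrE// mulr_ge0.
have h3 : (s.+1%:R : R) <= (s - Q)%N%:R + Q.+1%:R by rewrite -natrD ler_nat; lia.
rewrite mulrDl (le_trans h3)// lerD//.
by rewrite ler_peMr.
Qed.

Lemma sum_blocks (F : nat -> nat) (a c : nat) :
  (\sum_(i < a * c) F i = \sum_(J < a) \sum_(j < c) F (J * c + j))%N.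
Proof.
elim: a => [|a IH]; first by rewrite mul0n !big_ord0.
have E : (\sum_(a * c <= i < c + a * c) F i = \sum_(j < c) F (a * c + j))%N.
  rewrite -{1}[(a * c)%N]add0n big_addn addnK big_mkord.
  by apply: eq_bigr => j _; rewrite addnC.
rewrite big_ord_recr/= -IH -E -!(big_mkord xpredT F) mulSn.
by rewrite (big_cat_nat (n := a * c)%N)//= leq_addl.
Qed.

End counting_tools.

(** * Counting the cells hit by a set *)

Section counting.
Context (R : realType) (M : nat).
Hypothesis M_ge2 : (2 <= M)%N.
Local Notation r := (M%:R : R).
Local Notation grid := (@grid_point R M).
Local Notation cell := (@cell_index R M).

Let r_gt0 : 0 < r. Proof. by rewrite ltr0n (leq_trans _ M_ge2). Qed.
Let rn_gt0 n : 0 < r ^+ n. Proof. by rewrite exprn_gt0. Qed.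

Definition hit (A : set R) (n p : nat) : bool :=
  `[< A `&` `[p%:R / M%:R ^+ n, p.+1%:R / M%:R ^+ n[ !=set0 >].

Lemma box_countE (A : set R) n : box_count A M n = (\sum_(p < M ^ n) hit A n p)%N.
Proof.
rewrite /box_count -sum1_card big_mkcond/=; apply: eq_bigr => p _.
by rewrite inE -/(hit A n p); case: hit.
Qed.

Lemma cellE (n p : nat) (x : R) : grid n p <= x < grid n p.+1 -> cell n x = p.
Proof.
rewrite /grid_point => /andP[]; rewrite ler_pdivrMr// ltr_pdivlMr// => h1 h2.
by apply/eqP; rewrite truncn_eq ?h1// (le_trans _ h1).
Qed.

Lemma grid_block (m l J j : nat) : (j < M ^ l)%N ->
  grid m J <= grid (m + l) (J * M ^ l + j) /\
  grid (m + l) (J * M ^ l + j).+1 <= grid m J.+1.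
Proof.
move=> jl; have gE K : grid m K = (K * M ^ l)%N%:R / r ^+ (m + l).
  by rewrite /grid_point natrM natrX exprD invfM mulrACA divff ?gt_eqF// mulr1.
rewrite !gE /grid_point !ler_pM2r ?invr_gt0// !ler_nat leq_addr; split => //.
by rewrite mulSn -addnS addnC leq_add2r.
Qed.

Lemma hit_block (A : set R) (m l J j : nat) : (j < M ^ l)%N ->
  hit A (m + l) (J * M ^ l + j) -> hit A m J.
Proof.
move=> jl /asboolP[x [Ax /=]]; rewrite in_itv/= => /andP[x1 x2].
have [g1 g2] := grid_block m J jl.
apply/asboolP; exists x; split => //=; rewrite in_itv/=.
by rewrite (le_trans g1 x1) (lt_le_trans x2 g2).
Qed.

(** The chain starts at the leftmost hit cell of the block.  The values of b at the
    left end points of two hit cells differ by at most D0 e, the oscillation on A in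
    the block, plus D1 e for each of the two cells; the s other hit cells therefore
    satisfy the hypotheses of [chain_weight_ge]. *)
Lemma block_count_chain (A : set R) (b : R -> R) (m l J Q s : nat) (e D0 D1 W : R) :
  0 < e -> A `<=` `[0, 1] -> (J < M ^ m)%N ->
  (forall x, 0 <= x < 1 -> `|b x - b (grid (m + l) (cell (m + l) x))| <= D1 * e) ->
  (forall i, (i < M ^ (m + l))%N ->
    chain_weight (M ^ (m + l)) (M ^ l) e (fun k => b (grid (m + l) k)) Q i <= W) ->
  (forall x y, A x -> A y -> grid m J <= x < grid m J.+1 -> grid m J <= y < grid m J.+1 ->
    `|b x - b y| <= D0 * e) ->
  (\sum_(j < M ^ l) hit A (m + l) (J * M ^ l + j))%N = s.+1 ->
  expR (- ((D0 + 2 * D1) ^+ 2 / 2)) ^+ Q * 'C(s, Q)%:R <= W.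
Proof.
move=> e0 A01 JM osc cw good.
pose S := [seq p <- iota (J * M ^ l) (M ^ l) | hit A (m + l) p].
have SJ p : p \in S -> exists2 j, (j < M ^ l)%N & p = (J * M ^ l + j)%N.
  rewrite mem_filter mem_iota => /and3P[_ p1 p2]; exists (p - J * M ^ l)%N.
    by rewrite ltn_subLR.
  by rewrite subnKC.
have SM p : p \in S -> (p < M ^ (m + l))%N.
  move=> /SJ[j jl ->]; apply: (@leq_trans (J.+1 * M ^ l)).
    by rewrite mulSn addnC ltn_add2r.
  by rewrite expnD leq_mul2r JM orbT.
have -> : (\sum_(j < M ^ l) hit A (m + l) (J * M ^ l + j))%N = size S.
  rewrite size_filter -sum1_count.
  have -> : iota (J * M ^ l) (M ^ l) = [seq (J * M ^ l + j)%N | j <- iota 0 (M ^ l)].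
    by rewrite -iotaDl addn0.
  rewrite big_map -(big_mkord xpredT (fun j => (hit A (m + l) (J * M ^ l + j) : nat))).
  by rewrite /index_iota subn0 [RHS]big_mkcond/=; apply: eq_bigr => j _; case: hit.
have Spt p : p \in S ->
    exists x, [/\ A x, 0 <= x < 1, cell (m + l) x = p & grid m J <= x < grid m J.+1].
  move=> pS; have := pS; rewrite mem_filter => /andP[/asboolP[x [Ax xp]] _].
  move: xp; rewrite /= in_itv/= => xp; exists x; have [j jl pE] := SJ p pS.
  have [g1 g2] := grid_block m J jl.
  have /andP[x1 x2] := xp.
  split => //; last first.
  - by rewrite pE in x1 x2; rewrite (le_trans g1 x1) (lt_le_trans x2 g2).
  - exact: cellE.
  - rewrite (le_trans _ x1) ?divr_ge0 ?(ltW (rn_gt0 _))//= (lt_le_trans x2)//.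
    by rewrite ler_pdivrMr// mul1r -natrX ler_nat SM.
have close p q : p \in S -> q \in S ->
    `|b (grid (m + l) p) - b (grid (m + l) q)| <= (D0 + 2 * D1) * e.
  move=> /Spt[x [Ax x01 cx xJ]] /Spt[y [Ay y01 cy yJ]].
  have h1 := osc x x01; have h2 := osc y y01; have h3 := good x y Ax Ay xJ yJ.
  rewrite cx in h1; rewrite cy in h2.
  move: h1 h2 h3; rewrite !ler_norml => /andP[? ?] /andP[? ?] /andP[? ?].
  by apply/andP; split; nra.
have sS : sorted ltn S by apply: (sorted_filter ltn_trans); exact: iota_ltn_sorted.
case: S sS SJ SM close {Spt} => [|i S] //= sS SJ SM close [<-].
apply: le_trans (cw i (SM i (mem_head _ _))).
apply: chain_weight_ge => // k kS.
have kiS : k \in i :: S by rewrite inE kS orbT.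
rewrite (ltnW (SM k kiS))/=; have [j jl ->] := SJ k kiS.
have [j' jl' ->] := SJ i (mem_head _ _).
by rewrite -addnA leq_add2l (leq_trans (ltnW jl))// leq_addl.
Qed.

(** A block that is not hit contributes nothing, a good one at most G, a bad one at
    most its M^l cells. *)
Lemma box_count_block (A : set R) (m l : nat) (bad : nat -> bool) (G : R) : 0 <= G ->
  (forall J, (J < M ^ m)%N -> ~~ bad J ->
    (\sum_(j < M ^ l) hit A (m + l) (J * M ^ l + j))%N%:R <= G) ->
  (box_count A M (m + l))%:R <=
    G * (box_count A M m)%:R + (\sum_(J < M ^ m) bad J)%N%:R * r ^+ l.
Proof.
move=> G0 hG; rewrite !box_countE expnD (sum_blocks (fun p => hit A (m + l) p)).
rewrite !natr_sum mulr_sumr mulr_suml -big_split/=; apply: ler_sum => J _.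
have le_Ml : ((\sum_(j < M ^ l) hit A (m + l) (J * M ^ l + j))%N%:R : R) <= r ^+ l.
  rewrite -natrX ler_nat -[leqRHS](card_ord (M ^ l)) -sum1_card.
  by apply: leq_sum => j _; case: hit.
have [hJ|hJ] := boolP (hit A m J); last first.
  rewrite big1 => [|j _]; first by rewrite mulr0 add0r mulr_ge0 ?exprn_ge0 ?(ltW r_gt0).
  by apply/eqP; rewrite eqb0; apply: contra hJ; exact: hit_block.
rewrite mulr1; case: (boolP (bad J)) => bJ; first by rewrite mul1r ler_wpDl.
by rewrite mul0r addr0 hG.
Qed.

End counting.

(** * Cells of large oscillation *)

Section bad_cells.
Context (R : realType) (M : nat) (A : set R) (b : R -> R).
Hypothesis M_ge2 : (2 <= M)%N.
Local Notation r := (M%:R : R).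
Local Notation grid := (@grid_point R M).

Let r_gt0 : 0 < r. Proof. by rewrite ltr0n (leq_trans _ M_ge2). Qed.
Let rn_gt0 n : 0 < r ^+ n. Proof. by rewrite exprn_gt0. Qed.

Definition bad_cell (m : nat) (tau : R) (J : nat) : bool :=
  `[< exists x y, [/\ A x, A y, grid m J <= x < grid m J.+1, grid m J <= y < grid m J.+1 &
      tau < `|b x - b y|] >].

Lemma good_cellP m tau J x y : ~~ bad_cell m tau J -> A x -> A y ->
  grid m J <= x < grid m J.+1 -> grid m J <= y < grid m J.+1 -> `|b x - b y| <= tau.
Proof.
move=> /asboolPn nb Ax Ay xJ yJ; rewrite leNgt; apply/negP => h; apply: nb.
by exists x, y.
Qed.

(** Two points of a cell are at distance at most M^-m. *)
Lemma holder_no_bad_cell (c beta : R) m J : 0 <= c -> 0 <= beta ->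
  (forall x y, A x -> A y -> `|b x - b y| <= c * `|x - y| `^ beta) ->
  bad_cell m (c * r `^ (- (m%:R * beta))) J = false.
Proof.
move=> c0 beta0 hb; apply/asboolPn => -[x [y [Ax Ay /andP[x1 x2] /andP[y1 y2]]]].
apply/negP; rewrite -leNgt (le_trans (hb x y Ax Ay))// ler_wpM2l//.
have gS : grid m J.+1 = grid m J + (r ^+ m)^-1.
  by rewrite /grid_point -natr1 mulrDl mul1r.
have -> : r `^ (- (m%:R * beta)) = (r ^+ m)^-1 `^ beta.
  by rewrite -powR_mulrn ?(ltW r_gt0)// -powRN -powRrM mulNr.
apply: ge0_ler_powR; rewrite ?nnegrE ?invr_ge0 ?(ltW (rn_gt0 _))//.
by rewrite ler_norml; apply/andP; split; lra.
Qed.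

Lemma sum_odd_le (g : nat -> R) k : (forall i, 0 <= g i) ->
  \sum_(i < k) g i.*2.+1 <= \sum_(i < k.*2) g i.
Proof.
move=> g0; elim: k => [|k IH]; first by rewrite !big_ord0.
by rewrite doubleS !big_ord_recr/= lerD2r (le_trans IH)// lerDl g0.
Qed.

(** Choose in each bad cell two points of A, in increasing order, at which the values
    of b differ by more than tau.  Listed from left to right they form an increasing
    sequence, whose variation contains one term larger than tau for each bad cell. *)
Lemma bounded_variation_bad_cells (V tau : R) m : 0 <= tau ->
  ubound (variations_on A b) V ->
  (\sum_(J < M ^ m) bad_cell m tau J)%N%:R * tau <= `|V|.
Proof.
move=> tau0 hV; pose s := [seq J <- iota 0 (M ^ m) | bad_cell m tau J].
have -> : (\sum_(J < M ^ m) bad_cell m tau J)%N = size s.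
  rewrite size_filter -sum1_count -(big_mkord xpredT (fun J => (bad_cell m tau J : nat))).
  by rewrite /index_iota subn0 [RHS]big_mkcond/=; apply: eq_bigr => j _; case: bad_cell.
have sb J : J \in s -> bad_cell m tau J by rewrite mem_filter => /andP[].
have ss : sorted ltn s by apply: (sorted_filter ltn_trans); exact: iota_ltn_sorted.
have [k0|k0] := posnP (size s); first by rewrite k0 mul0r.
have /choice[f hf] : forall J, exists p : R * R, bad_cell m tau J ->
    [/\ A p.1, A p.2, grid m J <= p.1 < p.2, p.2 < grid m J.+1 & tau < `|b p.2 - b p.1|].
  move=> J; have [bJ|_] := boolP (bad_cell m tau J); last by exists (0, 0).
  have /asboolP[x [y [Ax Ay /andP[x1 x2] /andP[y1 y2] t]]] := bJ.
  have [xy|yx|xy] := ltgtP x y.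
  - by exists (x, y) => _; split => //=; [rewrite x1|rewrite distrC].
  - by exists (y, x) => _; split => //=; rewrite y1.
  - by move: t; rewrite xy subrr normr0 ltNge tau0.
(* the two points chosen in bad cell number i./2 *)
pose X (i : nat) : R := if odd i then (f (nth 0%N s i./2)).2 else (f (nth 0%N s i./2)).1.
have half i : (i < (size s).*2)%N -> (i./2 < size s)%N by rewrite ltn_half_double.
have nb i : (i < (size s).*2)%N -> bad_cell m tau (nth 0%N s i./2).
  by move=> /half h; apply: sb; exact: mem_nth.
have size2 : ((size s).*2.-1.+1 = (size s).*2)%N by rewrite prednK// double_gt0.
have AX i : (i <= (size s).*2.-1)%N -> A (X i).
  rewrite -ltnS size2 => h; have [A1 A2 _ _ _] := hf _ (nb i h).
  by rewrite /X; case: ifP.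
have incX i : (i < (size s).*2.-1)%N -> X i < X i.+1.
  move=> h; have h1 : (i.+1 < (size s).*2)%N by rewrite -size2 ltnS.
  have [A1 A2 /andP[x1 x2] x3 _] := hf _ (nb i (ltnW h1)).
  rewrite /X /= uphalf_half; case: (boolP (odd i)) => oi /=; last by rewrite add0n.
  rewrite add1n.
  have h2 : (i./2.+1 < size s)%N.
    by have := half _ h1; rewrite /= uphalf_half oi add1n.
  have [_ _ /andP[y1 _] _ _] := hf _ (sb _ (mem_nth 0%N h2)).
  apply: (lt_le_trans x3); apply: le_trans y1.
  rewrite /grid_point ler_pM2r ?invr_gt0// ler_nat.
  by have := sorted_ltn_nth ltn_trans 0%N ss; apply => //; rewrite inE// ltnW.
(* [g 0] vanishes, and the odd terms are the differences inside the bad cells *)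
pose g (i : nat) : R := `|b (X i) - b (X i.-1)|.
have vg : \sum_(1 <= i < (size s).*2.-1.+1) g i = \sum_(i < (size s).*2) g i.
  rewrite -(big_mkord xpredT g) size2 [RHS]big_ltn ?double_gt0//.
  by rewrite {2}/g /= subrr normr0 add0r.
have : variations_on A b (\sum_(i < (size s).*2) g i).
  exists (size s).*2.-1, X; split => //.
  by case: (size s) k0 => // k _; rewrite doubleS.
move=> /hV h; rewrite (le_trans _ (ler_norm V))// (le_trans _ h)//.
have g0 i : 0 <= g i by exact: normr_ge0.
apply: le_trans (sum_odd_le (size s) g0).
have -> : (size s)%:R * tau = \sum_(i < size s) tau.
  by rewrite sumr_const card_ord mulr_natl.
apply: ler_sum => i _; have hi := mem_nth 0%N (ltn_ord i).
have [_ _ _ _ h3] := hf _ (sb _ hi).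
by rewrite /g /X /= odd_double/= uphalf_double doubleK ltW.
Qed.

End bad_cells.

(** * Growth exponents *)

Section growth.
Context (R : realType) (r : R) (r_gt1 : 1 < r).

(** By strong induction N n <= D r^(n theta).  The exponent of the first term is at
    most 2 n delta + l (1 - alpha) + (n - l) theta, and
    l (theta - (1 - alpha)) >= l eta >= n eta / K leaves room, after 2 n delta, for a
    further factor r^(n k), which exceeds 2 C for large n.  The first term is thus
    at most half of the target, and the second one at most the other half because
    D >= 2 V. *)
Lemma growth_recursion (N : nat -> R) (K : nat) (alpha theta eta delta C V : R) :
  (2 <= K)%N -> 0 < eta -> 0 <= C -> 0 <= V -> 0 <= theta -> alpha < 1 ->
  1 - alpha + eta <= theta -> 4 * delta * K%:R <= eta ->
  (forall n, 0 <= N n <= r ^+ n) ->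
  (forall n, (0 < n)%N -> N n <= C * r `^ (2 * n%:R * delta + (n %/ K).+1%:R * (1 - alpha))
      * N (n - (n %/ K).+1)%N + V * r `^ (n%:R * theta)) ->
  exists D, forall n, N n <= D * r `^ (n%:R * theta).
Proof.
move=> K2 eta0 C0 V0 th0 a1 th dK N01 rec.
have r0 : 0 < r by exact: lt_trans r_gt1.
have K0 : (0 : R) < K%:R by rewrite ltr0n (leq_trans _ K2).
have lnr0 : 0 < ln r by rewrite ln_gt0.
pose k := eta / (2 * K%:R); have k0 : 0 < k by rewrite divr_gt0// mulr_gt0.
pose n0 := (Num.truncn (2 * C / (k * ln r))).+1.
have Csmall n : (n0 <= n)%N -> C <= 2^-1 * r `^ (n%:R * k).
  move=> nn; have h1 : 1 + n%:R * k * ln r <= r `^ (n%:R * k).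
    by rewrite /powR gt_eqF// expR_ge1Dx.
  have h2 : 2 * C / (k * ln r) <= n%:R.
    by rewrite (le_trans (ltW (truncnS_gt _)))// ler_nat.
  move: h1 h2; rewrite ler_pdivrMr ?(mulr_gt0 k0 lnr0)//.
  by clearbody k; set p := r `^ _; set q := ln r; lra.
pose D := r ^+ n0 + 2 * V.
have D0 : 0 <= D by rewrite addr_ge0 ?exprn_ge0 ?mulr_ge0// ltW.
exists D => n; elim/ltn_ind: n => n IH.
have [nn|nn] := ltnP n n0.
  have /andP[_ h] := N01 n; apply: (le_trans h).
  rewrite -[leLHS]mulr1; apply: ler_pM; rewrite ?exprn_ge0 ?(ltW r0)//.
    apply: (@le_trans _ _ (r ^+ n0)); first by rewrite ler_eXn2l// ltnW.
    by rewrite /D lerDl mulr_ge0.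
  by rewrite -[leLHS](powRr0 r) ler_powR ?(ltW r_gt1)// mulr_ge0.
have n1 : (0 < n)%N by exact: leq_trans nn.
set l := (n %/ K).+1 in rec *.
have le_ln : (l <= n)%N by rewrite /l ltn_Pdiv.
have lK : n%:R / K%:R <= l%:R :> R.
  rewrite ler_pdivrMr// -natrM ler_nat /l mulSn {1}(divn_eq n K) addnC leq_add2r ltnW//.
  by rewrite ltn_mod (leq_trans _ K2).
have := IH (n - l)%N; rewrite ltn_subrL n1 => /(_ isT) IHm.
apply: (le_trans (rec n n1)); rewrite -/l.
have pw x : 0 < r `^ x by exact: powR_gt0.
apply: (@le_trans _ _ (2^-1 * D * r `^ (n%:R * theta) + V * r `^ (n%:R * theta))).
  rewrite lerD2r; apply: (@le_trans _ _ (2^-1 * r `^ (n%:R * k) *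
      r `^ (2 * n%:R * delta + l%:R * (1 - alpha)) * (D * r `^ ((n - l)%N%:R * theta)))).
    apply: ler_pM => //; first by rewrite mulr_ge0// ltW.
    - by have /andP[] := N01 (n - l)%N.
    - by rewrite ler_pM2r// Csmall.
  rewrite [leLHS](_ : _ = 2^-1 * D * (r `^ (n%:R * k) *
     r `^ (2 * n%:R * delta + l%:R * (1 - alpha)) * r `^ ((n - l)%N%:R * theta))); last by ring.
  rewrite ler_wpM2l ?mulr_ge0 ?invr_ge0// -!powRD ?(gt_eqF r0) ?implybT//.
  rewrite ler_powR ?(ltW r_gt1)// natrB//.
  have e1 : n%:R * k + 2 * n%:R * delta <= n%:R / K%:R * eta.
    have : 2 * n%:R * delta <= n%:R * k.
      rewrite -mulrA mulrCA ler_wpM2l// /k ler_pdivlMr ?mulr_gt0//; lra.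
    have -> : n%:R / K%:R * eta = n%:R * k + n%:R * k by rewrite /k; field; rewrite gt_eqF.
    lra.
  have e2 : n%:R / K%:R * eta <= l%:R * (theta - (1 - alpha)).
    by apply: ler_pM; rewrite ?divr_ge0 ?(ltW eta0)//; lra.
  by move: e1 e2; rewrite !mulrBr !mulrBl; lra.
rewrite -mulrDl ler_pM2r// /D.
have : 0 <= r ^+ n0 by rewrite exprn_ge0// ltW.
by move: (r ^+ n0) => x x0; clear -x0 V0; lra.
Qed.

Lemma limn_esup_le_eventually (u : nat -> R) (x : R) :
  (forall eta, 0 < eta -> \forall n \near \oo, u n <= x + eta) ->
  (limn_esup (EFin \o u) <= x%:E)%E.
Proof.
move=> h; apply/lee_addgt0Pr => eta eta0.
have [m _ hm] := h eta eta0.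
rewrite limn_esup_lim; apply: lime_le.
  by apply/cvg_ex; eexists; exact: cvg_esups_inf.
exists m => // n /= mn; apply: ge_ereal_sup => _ [k /= nk <-].
by rewrite -EFinD lee_fin; apply: hm => /=; exact: leq_trans nk.
Qed.

(** The constant D disappears after division by n; spending only eta/2 on the
    exponent leaves room for it. *)
Lemma log_growth_limsup (N : nat -> nat) (theta : R) : 0 <= theta ->
  (forall eta, 0 < eta -> exists D, forall n, (N n)%:R <= D * r `^ (n%:R * (theta + eta))) ->
  (limn_esup (fun n => (ln (N n)%:R / (n%:R * ln r))%:E) <= theta%:E)%E.
Proof.
move=> th0 h; apply: (limn_esup_le_eventually (u := fun n => ln (N n)%:R / (n%:R * ln r))).
move=> eta eta0; have r0 : 0 < r by exact: lt_trans r_gt1.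
have e20 : 0 < eta / 2 by rewrite divr_gt0.
have [D hD] := h _ e20.
have lnr0 : 0 < ln r by rewrite ln_gt0.
exists (Num.truncn (`|ln D| / (eta / 2 * ln r))).+1 => // n /= nn.
have n1 : (0 : R) < n%:R by rewrite ltr0n (leq_trans _ nn).
have nl : 0 < n%:R * ln r by rewrite mulr_gt0.
have [N0|N0] := posnP (N n).
  by rewrite N0 ln0// mul0r addr_ge0// ltW.
rewrite ler_pdivrMr//.
have Nn : (0 : R) < (N n)%:R by rewrite ltr0n.
have D0 : 0 < D.
  by have := lt_le_trans Nn (hD n); rewrite pmulr_lgt0// powR_gt0.
have : ln (N n)%:R <= ln (D * r `^ (n%:R * (theta + eta / 2))).
  by rewrite ler_ln ?posrE ?mulr_gt0 ?powR_gt0.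
rewrite lnM ?posrE ?powR_gt0// ln_powR => hl; apply: (le_trans hl).
have : `|ln D| / (eta / 2 * ln r) <= n%:R.
  by rewrite (le_trans (ltW (truncnS_gt _)))// ler_nat.
rewrite ler_pdivrMr ?mulr_gt0// => h2.
have := ler_norm (ln D).
rewrite (_ : (theta + eta) * (n%:R * ln r) =
  n%:R * (theta + eta / 2) * ln r + n%:R * (eta / 2 * ln r)); last by field.
lra.
Qed.

End growth.

(** * Dimension bounds along a good path *)

Section good_paths.
Context (R : realType) (alpha : R) (M : nat).
Hypotheses (alpha_gt0 : 0 < alpha) (alpha_lt1 : alpha < 1).
Hypothesis M_ge2 : (2 <= M)%N.
Local Notation r := (M%:R : R).
Local Notation grid := (@grid_point R M).

Let r_gt1 : 1 < r. Proof. by rewrite ltr1n. Qed.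
Let r_gt0 : 0 < r. Proof. by rewrite ltr0n (leq_trans _ M_ge2). Qed.
Let rE n : r ^+ n = r `^ n%:R. Proof. by rewrite powR_mulrn// ltW. Qed.

(** The almost sure properties of the path on which the deterministic part relies.
    With delta = 1 / (j + 1) and chains of length 3 (j + 1), the factor M^(3 n) paid
    for the union over starting points is exactly the Q-th power of M^(n delta). *)
Record good_path (b : R -> R) : Prop := {
  good_path_continuous : {within `[0, 1], continuous b};
  good_path_increments : exists D, forall n p, (p < M ^ n)%N ->
    expR ((r `^ (n%:R * alpha) * (b (grid n p.+1) - b (grid n p))) ^+ 2 / 4) <=
      D * r ^+ (2 * n);
  good_path_chains : forall j : nat, exists D, forall n l i,
    (l <= n)%N -> (i < M ^ n)%N ->
    chain_weight (M ^ n) (M ^ l) (r `^ (- (n%:R * (alpha - j.+1%:R^-1))))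
      (fun k => b (grid n k)) (3 * j.+1) i <=
    D * r ^+ (3 * n) *
      (r `^ (n%:R * j.+1%:R^-1) * r `^ (l%:R * (1 - alpha))) ^+ (3 * j.+1) }.

(** On a good block the threshold D0 M^-(n alpha) is finer than the oscillation
    M^-(n (alpha - delta)) of b on cells, so [block_count_chain] and
    [linear_bound_of_binomial] bound the number of hit cells, and [box_count_block]
    gives the recursion solved by [growth_recursion].  The parameter delta is taken
    so small that 4 delta K <= eta. *)
Lemma box_count_growth (b : R -> R) (A : set R) (theta eta D0 V : R) (K : nat) :
  good_path b -> A `<=` `[0, 1] -> 0 < eta -> 0 <= theta -> 1 - alpha + eta <= theta ->
  0 <= D0 -> 0 <= V -> (2 <= K)%N ->
  (forall n, (0 < n)%N ->
    (\sum_(J < M ^ (n - (n %/ K).+1))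
        bad_cell M A b (n - (n %/ K).+1) (D0 * r `^ (- (n%:R * alpha))) J)%N%:R *
      r ^+ (n %/ K).+1 <= V * r `^ (n%:R * theta)) ->
  exists D, forall n, (box_count A M n)%:R <= D * r `^ (n%:R * theta).
Proof.
move=> [cb [Dx hDx] hch] A01 eta0 th0 th D00 V0 K2 hbad.
have K0 : (0 : R) < K%:R by rewrite ltr0n (leq_trans _ K2).
pose j := Num.truncn (alpha^-1 + 4 * K%:R / eta).
pose delta : R := j.+1%:R^-1; pose Q := (3 * j.+1)%N.
have jb : alpha^-1 + 4 * K%:R / eta < j.+1%:R by exact: truncnS_gt.
have ai : 0 < alpha^-1 by rewrite invr_gt0.
have ki : 0 < 4 * K%:R / eta by rewrite divr_gt0// mulr_gt0.
have d0 : 0 < delta by rewrite invr_gt0.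
have da : delta < alpha.
  by rewrite /delta -[ltRHS]invrK ltf_pV2 ?posrE//; lra.
have dK : 4 * delta * K%:R <= eta.
  have : 4 * K%:R / eta <= j.+1%:R by lra.
  rewrite ler_pdivrMr// => h; rewrite mulrAC /delta ler_pdivrMr ?ltr0n//.
  by rewrite [leRHS]mulrC.
have g0 : 0 < alpha - delta by rewrite subr_gt0.
have [C1 C10 hinc] := grid_increments_le M_ge2 d0 hDx.
have [D1 D10 hosc] := cell_oscillation M_ge2 cb g0 hinc.
have [D2 hW] := hch j.
pose c := expR (- ((D0 + 2 * D1) ^+ 2 / 2)) ^+ Q.
have c0 : 0 < c by rewrite exprn_gt0// expR_gt0.
pose C := Num.max 1 (Q`!%:R * D2 / c) + Q.+1%:R.
have C0 : 0 <= C by rewrite addr_ge0// le_max ler01.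
apply: (@growth_recursion R r r_gt1 (fun n => (box_count A M n)%:R)
  K alpha theta eta delta C V) => //.
  move=> n; rewrite ler0n -natrX ler_nat box_countE -[leqRHS](card_ord (M ^ n)) -sum1_card.
  by apply: leq_sum => p _; case: hit.
move=> n n1; have := hbad n n1; set l := (n %/ K).+1; set m := (n - l)%N => hb.
have le_ln : (l <= n)%N by rewrite /l ltn_Pdiv.
have nml : n = (m + l)%N by rewrite subnK.
pose X := r `^ (2 * n%:R * delta + l%:R * (1 - alpha)).
have X1 : 1 <= X.
  rewrite -[leLHS](powRr0 r) ler_powR ?(ltW r_gt1)//.
  by rewrite addr_ge0// mulr_ge0 ?subr_ge0 ?(ltW alpha_lt1)// ?mulr_ge0 ?(ltW d0).
pose e := r `^ (- (n%:R * (alpha - delta))).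
have e0 : 0 < e by rewrite powR_gt0.
have WX : D2 * r ^+ (3 * n) * (r `^ (n%:R * delta) * r `^ (l%:R * (1 - alpha))) ^+ Q
    <= D2 * X ^+ Q.
  rewrite -mulrA le_eqVlt; apply/orP; left; apply/eqP; congr (_ * _).
  have -> : r ^+ (3 * n) = (r `^ (n%:R * delta)) ^+ Q.
    rewrite rE -powR_mulrn ?powR_ge0// -powRrM; congr (_ `^ _).
    have : (j.+1%:R : R) != 0 by rewrite pnatr_eq0.
    by rewrite /Q !natrM /delta; set x := j.+1%:R => x0; field.
  rewrite -exprMn; congr (_ ^+ _).
  by rewrite mulrA -!powRD ?(gt_eqF r_gt0) ?implybT//; congr (_ `^ _); ring.
pose bad := bad_cell M A b m (D0 * r `^ (- (n%:R * alpha))).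
have hG J : (J < M ^ m)%N -> ~~ bad J ->
    (\sum_(i < M ^ l) hit M A (m + l) (J * M ^ l + i))%N%:R <= C * X.
  move=> JM gJ; case E : (\sum_(i < M ^ l) hit M A (m + l) (J * M ^ l + i))%N => [|s].
    by rewrite mulr_ge0// (le_trans _ X1).
  have bc := @linear_bound_of_binomial R Q c D2 X _ s isT c0 X1 WX; apply: bc.
  apply: (@block_count_chain R M M_ge2 A b m l J Q s e D0 D1) => //; rewrite -?nml.
  - by move=> x x01; exact: hosc.
  - by move=> i iM; exact: hW.
  - move=> x y Ax Ay xJ yJ; apply: le_trans (good_cellP gJ Ax Ay xJ yJ) _.
    rewrite ler_wpM2l// ler_powR ?(ltW r_gt1)// lerN2 ler_wpM2l// gerBl ltW//.
have CX0 : 0 <= C * X by rewrite mulr_ge0// (le_trans _ X1).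
have := box_count_block M_ge2 CX0 hG; rewrite -nml => h; apply: (le_trans h).
by rewrite lerD2l.
Qed.

Lemma bad_cell_le (A : set R) (b : R -> R) m (tau tau' : R) J : tau' <= tau ->
  bad_cell M A b m tau J -> bad_cell M A b m tau' J.
Proof.
move=> tau_le /asboolP[x [y [Ax Ay xJ yJ h]]]; apply/asboolP; exists x, y; split => //.
exact: le_lt_trans h.
Qed.

Lemma exists_nat_ge2 (x : R) : exists2 K : nat, (2 <= K)%N & x <= K%:R.
Proof.
exists (Num.truncn x).+2 => //.
by rewrite (le_trans (ltW (truncnS_gt _)))// ler_nat.
Qed.

(** At level m = n - l with l <= n / K + 1, the oscillation c M^-(m beta) on a block is
    at most c M^beta M^-(n alpha) once K >= beta / (beta - alpha), so no block is
    bad. *)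
Lemma holder_dimension_le (b : R -> R) (A : set R) (beta : R) :
  good_path b -> A `<=` `[0, 1] -> alpha < beta -> holder_on A beta b ->
  (upper_minkowski_dim M A <= (1 - alpha)%:E)%E.
Proof.
move=> gb A01 ab [c c0 hc].
apply: log_growth_limsup => //; first by rewrite subr_ge0 ltW.
move=> eta eta0.
have [K K2 hK] := exists_nat_ge2 (beta / (beta - alpha)).
have K0 : (0 : R) < K%:R by rewrite ltr0n (leq_trans _ K2).
have b0 : 0 < beta by exact: lt_trans ab.
have hK' : alpha <= beta - beta / K%:R.
  rewrite ler_pdivrMr ?subr_gt0// in hK.
  rewrite lerBrDr -lerBrDl ler_pdivrMr// mulrC //.
apply: (@box_count_growth b A (1 - alpha + eta) eta (c * r `^ beta) 0 K) => //.
- by rewrite addr_ge0 ?subr_ge0 ?(ltW alpha_lt1)// ltW.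
- by rewrite mulr_ge0 ?powR_ge0// ltW.
move=> n n1; set l := (n %/ K).+1; set m := (n - l)%N.
have le_ln : (l <= n)%N by rewrite /l ltn_Pdiv.
rewrite mul0r big1 ?mul0r// => J _; apply/eqP; rewrite eqb0; apply/negP => bJ.
have := @holder_no_bad_cell R M A b M_ge2 c beta m J (ltW c0) (ltW b0) hc.
rewrite (bad_cell_le _ bJ)// -mulrA ler_wpM2l ?(ltW c0)//.
rewrite -powRD ?(gt_eqF r_gt0) ?implybT// ler_powR ?(ltW r_gt1)//.
have lK : (l%:R : R) <= n%:R / K%:R + 1.
  by rewrite /l -natr1 lerD2r ler_pdivlMr// -natrM ler_nat leq_trunc_div.
rewrite natrB//.
have h1 : n%:R * alpha <= n%:R * (beta - beta / K%:R) by rewrite ler_wpM2l.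
have h2 : l%:R * beta <= (n%:R / K%:R + 1) * beta by rewrite ler_wpM2r// ltW.
by rewrite mulrBl; lra.
Qed.

(** There are at most |V| M^(n alpha) bad blocks, each with M^l <= M M^(n / K) cells;
    for K >= 1 / eta their total is of order M^(n (alpha + eta)). *)
Lemma bounded_variation_dimension_le (b : R -> R) (A : set R) :
  good_path b -> A `<=` `[0, 1] -> bounded_variation_on A b ->
  (upper_minkowski_dim M A <= (Num.max (1 - alpha) alpha)%:E)%E.
Proof.
move=> gb A01 [V hV].
have t1 : 1 - alpha <= Num.max (1 - alpha) alpha by rewrite le_max lexx.
have t2 : alpha <= Num.max (1 - alpha) alpha by rewrite le_max lexx orbT.
set t := Num.max _ _ in t1 t2 *.
have t0 : 0 <= t by rewrite (le_trans (ltW alpha_gt0)).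
apply: log_growth_limsup => // eta eta0.
have [K K2 hK] := exists_nat_ge2 eta^-1.
have K0 : (0 : R) < K%:R by rewrite ltr0n (leq_trans _ K2).
have hK' : K%:R^-1 <= eta by rewrite -[leRHS]invrK lef_pV2 ?posrE ?invr_gt0.
apply: (@box_count_growth b A (t + eta) eta 1 (`|V| * r) K) => //.
- by rewrite addr_ge0// ltW.
- by rewrite lerD2r.
move=> n n1; set l := (n %/ K).+1; set m := (n - l)%N.
have lK : (l%:R : R) <= n%:R / K%:R + 1.
  by rewrite /l -natr1 lerD2r ler_pdivlMr// -natrM ler_nat leq_trunc_div.
rewrite mul1r.
have := @bounded_variation_bad_cells R M A b M_ge2 V (r `^ (- (n%:R * alpha))) m
  (powR_ge0 _ _) hV.
rewrite powRN ler_pdivrMr ?powR_gt0// => h.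
apply: (le_trans (ler_wpM2r _ h)); first by rewrite exprn_ge0// ltW.
have -> : `|V| * r * r `^ (n%:R * (t + eta)) = `|V| * r `^ (1 + n%:R * (t + eta)).
  by rewrite powRD ?(gt_eqF r_gt0) ?implybT// powRr1 ?(ltW r_gt0)// mulrA.
rewrite -mulrA ler_wpM2l// rE -powRD ?(gt_eqF r_gt0) ?implybT//.
rewrite ler_powR ?(ltW r_gt1)//.
have h3 : n%:R * K%:R^-1 <= n%:R * eta by rewrite ler_wpM2l.
have h4 : n%:R * alpha <= n%:R * t by rewrite ler_wpM2l.
by rewrite mulrDr; lra.
Qed.

End good_paths.

Theorem theorem1p3 (R : realType) (d : measure_display) (T : measurableType d)
    (P : probability T R) (alpha : R) (B : R -> {RV P >-> R}) (M : nat)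
    (alpha_gt0 : 0 < alpha) (alpha_lt1 : alpha < 1)
    (fbmB : fractional_brownian_motion `[0, 1] alpha B)
    (M_ge2 : (2 <= M)%N) :
  {ae P, forall w : T, forall A : set R, A `<=` `[0, 1] -> A !=set0 ->
    ((exists2 beta : R, alpha < beta & holder_on A beta (fun t => B t w)) ->
       (upper_minkowski_dim M A <= (1 - alpha)%:E)%E) /\
    (bounded_variation_on A (fun t => B t w) ->
       (upper_minkowski_dim M A <= (Num.max (1 - alpha) alpha)%:E)%E)}.
Proof.
have gp : {ae P, forall w, good_path alpha M (fun t => B t w)}.
  have h3 := ae_foralln (fun j => @ae_chain_weights R d T P alpha B M alpha_gt0 alpha_lt1
    fbmB M_ge2 (3 * j.+1) j.+1%:R^-1).
  have h2 := ae_grid_increments_exp fbmB M_ge2.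
  by apply: filterS3 (fbm_continuous fbmB) h2 h3 => w c1 c2 c3; split.
apply: filterS gp => w gw A A01 _; split.
- by move=> [beta ab hb]; exact: holder_dimension_le gw A01 ab hb.
- exact: bounded_variation_dimension_le gw A01.
Qed.
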